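(* For any feasible tie-breaking functions, and for each number of candidates $j<5$, weighted constructive coalitional manipulation is solvable in polynomial time for ranked pairs (under the given tie-breaking functions), in both the nonunique-winner model and the unique-winner model.
   Context: An election consists of a finite candidate set $C$ and a collection of voters, each casting a tie-free linear order over $C$ and having a nonnegative integer weight. WMG: for distinct $c,d$, $D(c,d)$ = total weight of voters preferring $c$ to $d$ minus total weight preferring $d$ to $c$. Ranked pairs uses two feasible (polynomial-time computable) tie-breaking functions, a linear order on candidates and a linear order on unordered pairs of candidates: repeatedly take the not-yet-considered unordered pair $\{a,b\}$ with greatest $\max(D(a,b),D(b,a))$ (ties by the pair order); discard it if its relative order is already transitively implied by fixed orders, else fix the candidate with positive edge above the other (zero edges: candidate order decides); the top of the resulting linear order is the unique winner. Weighted constructive coalitional manipulation: given $C$ (here with $\|C\|=j$), weighted nonmanipulative voters $V$ with their votes, a collection $W$ of weighted manipulators (votes not yet set), and a distinguished $p\in C$: can tie-free linear-order votes be assigned to $W$ so that $p$ is a winner (nonunique-winner model) / the unique winner (unique-winner model) of the election with voters $V\cup W$? *)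

(* Defs.v *)
From HB Require Import structures.
From mathcomp Require Import all_boot all_order all_algebra.
Import Order.TTheory GRing.Theory Num.Theory.

Definition letter := 'I_3.
Definition l0 : letter := @Ordinal 3 0 isT.
Definition l1 : letter := @Ordinal 3 1 isT.
Definition lsep : letter := @Ordinal 3 2 isT.

Inductive move := MLeft | MRight | MStay.

Record TM := {
  tm_state : finType;
  tm_sym : finType;
  tm_start : tm_state;
  tm_halt : tm_state -> bool;
  tm_blank : tm_sym;
  tm_in : letter -> tm_sym;
  tm_out : tm_sym -> option letter;
  tm_delta : tm_state -> tm_sym -> tm_state * tm_sym * move }.

Set Implicit Arguments. Unset Strict Implicit. Unset Printing Implicit Defensive.

(* configuration: state, reversed left part, head cell, right part *)
Definition cfg (M : TM) :=
  (tm_state M * seq (tm_sym M) * tm_sym M * seq (tm_sym M))%type.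

Definition tm_step (M : TM) (c : cfg M) : cfg M :=
  let: (q, l, h, r) := c in
  if tm_halt M q then c else
  let: (q', s, m) := tm_delta M q h in
  match m with
  | MStay => (q', l, s, r)
  | MLeft => match l with
             | [::] => (q', [::], tm_blank M, s :: r)
             | x :: l' => (q', l', x, s :: r) end
  | MRight => match r with
             | [::] => (q', s :: l, tm_blank M, [::])
             | x :: r' => (q', s :: l, x, r') end
  end.

Definition tm_init (M : TM) (x : seq letter) : cfg M :=
  match map (tm_in M) x with
  | [::] => (tm_start M, [::], tm_blank M, [::])
  | y :: ys => (tm_start M, [::], y, ys)
  end.

Fixpoint read_out (M : TM) (s : seq (tm_sym M)) : seq letter :=
  match s with
  | [::] => [::]
  | y :: ys => match tm_out M y with
               | Some a => a :: read_out ys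
               | None => [::] end
  end.

Definition tm_output (M : TM) (c : cfg M) : seq letter :=
  let: (_, _, h, r) := c in read_out (h :: r).

Definition tm_state_of (M : TM) (c : cfg M) : tm_state M :=
  let: (q, _, _, _) := c in q.

Definition runs_to (M : TM) (x y : seq letter) (t : nat) : Prop :=
  let c := iter t (@tm_step M) (@tm_init M x) in
  tm_halt M (@tm_state_of M c) /\ @tm_output M c = y.

Definition poly_computable (X Y : Type) (dom : X -> Prop)
  (encX : X -> seq letter) (encY : Y -> seq letter) (f : X -> Y) : Prop :=
  exists (M : TM) (c k : nat), forall x, dom x ->
    runs_to M (encX x) (encY (f x)) (c * (size (encX x)) ^ k + c).

Definition enc_bool (b : bool) : seq letter := [:: if b then l1 else l0].

Definition poly_decidable (X : Type) (dom : X -> Prop)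
  (encX : X -> seq letter) (P : X -> Prop) : Prop :=
  exists (M : TM) (c k : nat), forall x, dom x ->
    exists b : bool, runs_to M (encX x) (enc_bool b) (c * (size (encX x)) ^ k + c)
                     /\ (b <-> P x).

Fixpoint bin (fuel n : nat) : seq bool :=
  match fuel with
  | 0 => [::]
  | f.+1 => if n == 0 then [::] else odd n :: bin f n./2
  end.

Definition enc_nat (n : nat) : seq letter :=
  map (fun b : bool => if b then l1 else l0) (bin n n) ++ [:: lsep].

Definition enc_nats (s : seq nat) : seq letter := flatten (map enc_nat s).

Definition enc_pairs (s : seq (nat * nat)) : seq letter :=
  enc_nats (flatten [seq [:: x.1; x.2] | x <- s]).

(* Candidates are natural numbers (names); a vote is a seq listing the
   candidates from most to least preferred; a voter is (weight, vote). *)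
Definition prefers (v : seq nat) (a b : nat) : bool := index a v < index b v.

Definition wmg (E : seq (nat * seq nat)) (a b : nat) : int :=
  \sum_(x <- E) ((if prefers x.2 a b then x.1 else 0)%:Z
                 - (if prefers x.2 b a then x.1 else 0)%:Z).

(* unordered pairs {a,b} represented by (min, max) *)
Definition upair (x : nat * nat) : nat * nat := (minn x.1 x.2, maxn x.1 x.2).

Definition allupairs (C : seq nat) : seq (nat * nat) :=
  [seq (a, b) | a <- C, b <- [seq b <- C | a < b]].

Fixpoint reach (E : seq (nat * nat)) (k : nat) (a b : nat) : bool :=
  match k with
  | 0 => false
  | k'.+1 => has (fun e => (e.1 == a) && ((e.2 == b) || reach E k' e.2 b)) E
  end.

Definition above (E : seq (nat * nat)) (a b : nat) : bool := reach E (size E) a b.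

Section RankedPairs.
Variables (C : seq nat) (E : seq (nat * seq nat))
          (ordC : seq nat) (ordP : seq (nat * nat)).
(* ordC : candidate tie-breaking order (earlier = higher priority)
   ordP : pair tie-breaking order (earlier = considered first) *)

Definition rp_strength (x : nat * nat) : int :=
  Num.max (wmg E x.1 x.2) (wmg E x.2 x.1).

Definition rp_pairpos (x : nat * nat) : nat := index (upair x) (map upair ordP).

Definition rp_before (x y : nat * nat) : bool :=
  (rp_strength y < rp_strength x)%R ||
  ((rp_strength x == rp_strength y) && (rp_pairpos x <= rp_pairpos y)).

Definition rp_sorted_pairs : seq (nat * nat) := sort rp_before (allupairs C).

Definition rp_step (F : seq (nat * nat)) (x : nat * nat) : seq (nat * nat) :=
  let: (a, b) := x in
  if above F a b || above F b a then F
  else if (0 < wmg E a b)%R then (a, b) :: F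
  else if (0 < wmg E b a)%R then (b, a) :: F
  else (if index a ordC < index b ordC then (a, b) else (b, a)) :: F.

Definition rp_fixed : seq (nat * nat) := foldl rp_step [::] rp_sorted_pairs.

Definition rp_winners : seq nat :=
  [seq c <- C | ~~ has (fun d => above rp_fixed d c) C].
End RankedPairs.

Record inst := Inst {
  icands : seq nat;
  ivoters : seq (nat * seq nat);
  imanip : seq nat;                 (* W : weights of manipulators *)
  idist : nat }.

Definition wf_inst (j : nat) (I : inst) : Prop :=
  [/\ uniq (icands I), size (icands I) = j,
      all (fun x => perm_eq x.2 (icands I)) (ivoters I) & idist I \in icands I].

Definition enc_inst (I : inst) : seq letter :=
  enc_nats ([:: size (icands I)] ++ icands I ++ [:: idist I; size (ivoters I)]
            ++ flatten [seq x.1 :: x.2 | x <- ivoters I]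
            ++ (size (imanip I) :: imanip I)).

Inductive winner_model := NonUnique | Unique.

Definition manipulable (tbC : seq nat -> seq nat) (tbP : seq nat -> seq (nat * nat))
  (m : winner_model) (I : inst) : Prop :=
  exists Wv : seq (seq nat),
    [/\ size Wv = size (imanip I),
        all (fun v => perm_eq v (icands I)) Wv &
        let ws := rp_winners (icands I) (ivoters I ++ zip (imanip I) Wv)
                    (tbC (icands I)) (tbP (icands I)) in
        match m with
        | NonUnique => idist I \in ws
        | Unique => ws = [:: idist I]
        end].

(* Main.v *)
Require Import Defs.
From mathcomp Require Import all_boot all_order all_algebra zify.
From Stdlib Require Import ClassicalEpsilon FunctionalExtensionality.

(** Let L be the ranking that ranked pairs outputs after a successful
    manipulation.  If all manipulators switch to the vote L, every margin in the
    direction of L can only grow; a pair fixed against the direction of its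
    margin was implied by stronger pairs, and these stay stronger.  So the output
    is again L, and only unanimous votes of the coalition need to be tried.

    Under a unanimous vote the winner depends on finitely many bits once the
    number of candidates is fixed: the positions of the candidates in the two
    tie-breaking orders, the position of p, and the comparisons between the
    numbers N(a,b) + e w, where N(a,b) is the weight of the nonmanipulators
    preferring a to b, w is the weight of the coalition, and e is 0 or 1 (margins
    are compared by comparing these sums, since N(a,b) + N(b,a) is constant).

    These bits are computed in polynomial time by a structured program acting on
    finitely many stacks, which is compiled to a single-tape Turing machine whose
    tape carries one track per stack.  All numbers are held in one stack of bit
    columns, so that each arithmetic operation is a finite-state pass over that
    stack reading one number from the input.  What remains is a function on a
    finite set, and needs no algorithm. *)

Set Implicit Arguments. Unset Strict Implicit. Unset Printing Implicit Defensive.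

(** * Stack machines on a single tape *)

(** The tie-breaking orders depend on the names of the candidates, and these are unbounded, so the
    orders cannot be tabulated: the program runs the two given machines on the list of names and
    keeps only the positions of the candidates in their outputs. Two instances that agree on all
    recorded bits are then related by a renaming of candidates, and a successful unanimous vote is
    carried along this renaming. The renaming step and the passage to a unanimous vote both compare
    two runs of ranked pairs, and one lemma on two runs serves both. Its delicate case is a pair
    fixed against its own direction, where the order is forced by earlier pairs and not by the pair
    itself. On the machine side all result types of programs are finite, so whatever a program
    remembers outside its stacks is control state. Hence names are turned into positions while they
    are read, and the final decision may be an arbitrary table. *)

Lemma iter1 T (f : T -> T) x : iter 1 f x = f x. Proof. by []. Qed.

Section StackMachine.
Variables (I G : finType).

Definition store := I -> seq G.
Definition upd (s : store) i v : store := fun k => if k == i then v else s k.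

Inductive instr (X : Type) :=
  | IPush of I & G & X
  | IPop of I & (option G -> X)
  | INop of X.

Definition ieval X (c : instr X) (s : store) : X * store :=
  match c with
  | IPush i a x => (x, upd s i (a :: s i))
  | IPop i f => if s i is a :: v then (f (Some a), upd s i v) else (f None, s)
  | INop x => (x, s)
  end.

Section Flowchart.
Variables (Q : finType) (code : Q -> instr (Q + bool)).

Fixpoint frun (t : nat) (x : Q + bool) (s : store) : (Q + bool) * store :=
  match t, x with
  | t'.+1, inl q => let: (x', s') := ieval (code q) s in frun t' x' s'
  | _, _ => (x, s)
  end.

Variables (start : Q + bool) (i0 : I) (emb : letter -> G).

(* The mark [Some None] singles out the leftmost cell, where all stacks have
   their bottoms; [Some (Some b)] is the output mark. *)
Let sym : finType := (option (option bool) * {ffun I -> option G})%type.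
Let tstate : finType := (bool + (Q + Q + (Q + bool)))%type.
(** Each instruction is a round trip from the marked cell: [TSeek] walks right to the first cell
    where the track of the stack is empty, [TTake] erases the symbol to the left of that cell, and
    [TBack] walks home carrying the next control point. *)
Definition TInit : tstate := inl false.
Definition THalt : tstate := inl true.
Definition TSeek q : tstate := inr (inl (inl q)).
Definition TTake q : tstate := inr (inl (inr q)).
Definition TBack x : tstate := inr (inr x).

Definition setc (y : {ffun I -> option G}) i v : {ffun I -> option G} :=
  [ffun k => if k == i then v else y k].

Definition stack_delta (st : tstate) (y : sym) : tstate * sym * move :=
  match st with
  | inl false => (TBack start, (Some None, y.2), MStay)
  | inl true => (st, y, MStay)
  | inr (inl (inl q)) =>
      match code q with
      | INop x => (TBack x, y, MStay)
      | IPush i a x => if y.2 i is Some _ then (st, y, MRight)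
                       else (TBack x, (y.1, setc y.2 i (Some a)), MStay)
      | IPop i f => if y.2 i is Some _ then (st, y, MRight)
                    else if y.1 is Some None then (TBack (f None), y, MStay)
                    else (TTake q, y, MLeft)
      end
  | inr (inl (inr q)) =>
      match code q with
      | IPop i f => (TBack (f (y.2 i)), (y.1, setc y.2 i None), MStay)
      | _ => (st, y, MStay)
      end
  | inr (inr x) =>
      if y.1 is Some None then
        match x with
        | inl q => (TSeek q, y, MStay)
        | inr b => (THalt, (Some (Some b), y.2), MStay)
        end
      else (st, y, MLeft)
  end.

Definition stack_TM : TM := {|
  tm_state := tstate; tm_sym := sym; tm_start := TInit;
  tm_halt := fun st => st == THalt;
  tm_blank := (None, [ffun => None]);
  tm_in := fun a => (None, [ffun i => if i == i0 then Some (emb a) else None]);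
  tm_out := fun y => if y.1 is Some (Some b) then Some (if b then l1 else l0) else None;
  tm_delta := stack_delta |}.

(** Stacks are lists with the top first, while their bottoms are aligned at cell 0, whence [rev]. A
    push or a pop then changes a single cell. *)
Definition cell (s : store) (p : nat) : sym :=
  (if p == 0 then Some None else None,
   [ffun i => nth None (map Some (rev (s i))) p]).

Definition tape (s : store) (m p : nat) (st : tstate) : cfg stack_TM :=
  (st, rev (map (cell s) (iota 0 p)), cell s p, map (cell s) (iota p.+1 (m - p.+1))).

Notation step := (@tm_step stack_TM).
Definition fits (s : store) m := forall i, size (s i) <= m.

Lemma cell_None s p i : (cell s p).2 i = None <-> size (s i) <= p.
Proof.
rewrite ffunE; split => [|h]; last by rewrite nth_default // size_map size_rev.
case: (leqP (size (s i)) p) => // h.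
case E: (s i) h => [|a v] // h.
by rewrite (nth_map a) // size_rev.
Qed.

Lemma cell_blank s m p : fits s m -> 0 < m -> m <= p -> cell s p = tm_blank stack_TM.
Proof.
move=> fs m0 mp; rewrite /cell; case: p mp => [|p] mp; first by lia.
congr (_, _); apply/ffunP=> i; rewrite !ffunE nth_default // size_map size_rev.
exact: leq_trans (fs i) mp.
Qed.

Lemma step_right s m p st st' : fits s m -> p < m -> st != THalt ->
  stack_delta st (cell s p) = (st', cell s p, MRight) ->
  step (tape s m p st) = tape s (maxn m p.+2) p.+1 st'.
Proof.
move=> fs pm nh D; rewrite /tm_step /tape [tm_halt _ _](negbTE nh) [tm_delta _ _ _]D.
have E : rev (map (cell s) (iota 0 p.+1)) = cell s p :: rev (map (cell s) (iota 0 p)).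
  by rewrite -addn1 iotaD map_cat rev_cat.
case: (leqP m p.+1) => h.
  have -> : m = p.+1 by lia.
  rewrite subnn /= E.
  have -> : maxn p.+1 p.+2 - p.+2 = 0 by lia.
  by rewrite (@cell_blank s m p.+1) //; lia.
have -> : m - p.+1 = (m - p.+2).+1 by lia.
by rewrite /= E; have -> : maxn m p.+2 = m by lia.
Qed.

Lemma step_left s m p st st' : p.+1 < m -> st != THalt ->
  stack_delta st (cell s p.+1) = (st', cell s p.+1, MLeft) ->
  step (tape s m p.+1 st) = tape s m p st'.
Proof.
move=> pm nh D; rewrite /tm_step /tape [tm_halt _ _](negbTE nh) [tm_delta _ _ _]D.
have -> : rev (map (cell s) (iota 0 p.+1)) = cell s p :: rev (map (cell s) (iota 0 p)).
  by rewrite -addn1 iotaD map_cat rev_cat.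
by have -> : m - p.+1 = (m - p.+2).+1 by lia.
Qed.

Lemma step_write s s' m p st st' : st != THalt -> p < m ->
  (forall k, k != p -> cell s' k = cell s k) ->
  stack_delta st (cell s p) = (st', cell s' p, MStay) ->
  step (tape s m p st) = tape s' m p st'.
Proof.
move=> nh pm Ek D; rewrite /tm_step /tape [tm_halt _ _](negbTE nh) [tm_delta _ _ _]D.
congr (_, rev _, _, _); apply/eq_in_map=> k; rewrite mem_iota => h; symmetry; apply: Ek;
  by apply/eqP; lia.
Qed.

Lemma step_stay s m p st st' : st != THalt -> p < m ->
  stack_delta st (cell s p) = (st', cell s p, MStay) ->
  step (tape s m p st) = tape s m p st'.
Proof. by move=> nh pm D; apply: step_write. Qed.

Lemma cell_upd_far s i v h k : (forall j, j < maxn (size (s i)) (size v) -> j != h ->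
   nth None (map Some (rev v)) j = nth None (map Some (rev (s i))) j) ->
  k != h -> cell (upd s i v) k = cell s k.
Proof.
move=> H kh; rewrite /cell; congr (_, _); apply/ffunP=> j; rewrite !ffunE /upd.
case: eqP => // ->; case: (ltnP k (maxn (size (s i)) (size v))) => hk; first exact: H.
by rewrite !nth_default // size_map size_rev; lia.
Qed.

Lemma cell_push_far s i a k : k != size (s i) ->
  cell (upd s i (a :: s i)) k = cell s k.
Proof.
apply: cell_upd_far => j /= hj nj; rewrite rev_cons map_rcons nth_rcons size_map size_rev.
by case: ltnP => // h; move: nj hj => /eqP; lia.
Qed.

Lemma cell_push s i a : cell (upd s i (a :: s i)) (size (s i)) =
  ((cell s (size (s i))).1, setc (cell s (size (s i))).2 i (Some a)).
Proof.
rewrite /cell /=; congr (_, _); apply/ffunP=> j; rewrite !ffunE /upd.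
by case: (j =P i) => // _; rewrite rev_cons map_rcons nth_rcons size_map size_rev ltnn eqxx.
Qed.

Lemma cell_pop_far s i a v k : s i = a :: v -> k != size v ->
  cell (upd s i v) k = cell s k.
Proof.
move=> E; apply: cell_upd_far => j; rewrite E /= => hj nj.
rewrite rev_cons map_rcons nth_rcons size_map size_rev.
by case: ltnP => // h; move: nj hj => /eqP; lia.
Qed.

Lemma cell_pop s i a v : s i = a :: v ->
  cell (upd s i v) (size v) = ((cell s (size v)).1, setc (cell s (size v)).2 i None).
Proof.
move=> E; rewrite /cell /=; congr (_, _); apply/ffunP=> j; rewrite !ffunE /upd.
by case: eqP => // _; rewrite nth_default // size_map size_rev.
Qed.

Lemma cell_top s i a v : s i = a :: v -> (cell s (size v)).2 i = Some a.
Proof. by move=> E; rewrite ffunE E rev_cons map_rcons nth_rcons size_map size_rev ltnn eqxx. Qed.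

Lemma back_home s m p x : p < m -> iter p step (tape s m p (TBack x)) = tape s m 0 (TBack x).
Proof.
elim: p => // p IH pm; rewrite iterSr (step_left (st' := TBack x)) //; first by apply: IH; lia.
Qed.

Lemma seek_top s m i q d p :
  (forall y : sym, y.2 i <> None -> stack_delta (TSeek q) y = (TSeek q, y, MRight)) ->
  fits s m -> p < m -> p + d = size (s i) ->
  iter d step (tape s m p (TSeek q)) = tape s (maxn m (p + d).+1) (p + d) (TSeek q).
Proof.
move=> D; elim: d m p => [|d IH] m p fs pm E.
  by rewrite addn0 (maxn_idPl _).
rewrite iterSr (step_right (st' := TSeek q)) //; last first.
  by apply: D => /cell_None; lia.
rewrite IH; last by lia.
- by rewrite -maxnA addSnnS; congr (tape _ (maxn _ _) _ _); lia.
- by move=> k; apply: leq_trans (fs k) _; lia.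
- by lia.
Qed.

Lemma fits_upd s m i v : fits s m -> size v <= m -> fits (upd s i v) m.
Proof. by move=> fs h k; rewrite /upd; case: eqP. Qed.

(** [m] bounds the heights of the stacks and the length of the tape in use. A round trip is linear
    in [m], and [m] grows by at most one per instruction; together these make the simulation of [t]
    instructions quadratic. *)
Lemma simulate_instr s m q (x' : Q + bool) s' : fits s m -> 0 < m ->
  ieval (code q) s = (x', s') ->
  exists n m', [/\ n <= m.*2 + 4, fits s' m', m' <= m.+1, 0 < m' &
    iter n step (tape s m 0 (TSeek q)) = tape s' m' 0 (TBack x')].
Proof.
move=> fs m0; case C: (code q) => [i a x|i f|x] /=; last first.
- case=> <- <-; exists 1, m; split; rewrite ?leqnSn ?addnS //.
  by apply: step_stay; rewrite //= C.
- case E: (s i) => [|a v] [<- <-].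
    exists 1, m; split; rewrite ?leqnSn ?addnS //.
    apply: step_stay => //.
    by rewrite /= C /=; have /cell_None /= -> : size (s i) <= 0 by rewrite E.
  have D (y : sym) : y.2 i <> None -> stack_delta (TSeek q) y = (TSeek q, y, MRight).
    by rewrite /= C; case: (y.2 i).
  have hv : size v < m by have := fs i; rewrite E.
  (* Read from the right: the walk to the empty cell above the top, one step back, the erasure, and
     the walk home. The head visits cell [(size v).+1], so the tape in use has at least
     [(size v).+2] cells. *)
  exists (size v + (1 + (1 + (size v).+1))), (maxn m (size v).+2).
  split; [by lia| |by lia|by lia|].
    by apply: fits_upd; [move=> k; apply: leq_trans (fs k) _; lia|lia].
  rewrite iterD iterD iterD (@seek_top _ _ i) //; last by rewrite add0n E.
  have D' : stack_delta (TSeek q) (cell s (size v).+1) = (TTake q, cell s (size v).+1, MLeft).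
    by rewrite /= C; have /cell_None /= -> : size (s i) <= (size v).+1 by rewrite E.
  rewrite add0n !iter1 (step_left (st' := TTake q) _ _ D') //; last by lia.
  rewrite (@step_write _ (upd s i v) _ _ _ (TBack (f (Some a)))) //; first 1 last.
  + by lia.
  + by move=> k; apply: cell_pop_far E.
  + by rewrite /stack_delta /= C (cell_top E) (cell_pop E).
  by rewrite back_home //; lia.
case=> <- <-.
have D (y : sym) : y.2 i <> None -> stack_delta (TSeek q) y = (TSeek q, y, MRight).
  by rewrite /= C; case: (y.2 i).
have hs := fs i.
exists (size (s i) + (1 + size (s i))), (maxn m (size (s i)).+1).
split; [by lia| |by lia|by lia|].
  by apply: fits_upd => /=; [move=> k; apply: leq_trans (fs k) _; lia|lia].
rewrite iterD iterD (@seek_top _ _ i) // add0n iter1.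
rewrite (@step_write _ (upd s i (a :: s i)) _ _ _ (TBack x)) //; first 1 last.
- by lia.
- by move=> k; apply: cell_push_far.
- rewrite /stack_delta /= C cell_push.
  by have /cell_None -> : size (s i) <= size (s i) by [].
by rewrite back_home //; lia.
Qed.

Lemma simulate_frun t x s m b s' : frun t x s = (inr b, s') -> fits s m -> 0 < m ->
  exists n m', [/\ n <= t * ((m + t).*2 + 5), 0 < m' &
    iter n step (tape s m 0 (TBack x)) = tape s' m' 0 (TBack (inr b))].
Proof.
elim: t x s m => [|t IH] x s m /=.
  by case=> -> -> _ m0; exists 0, m; split.
case: x => [q|c]; last by case=> -> -> _ m0; exists 0, m; split.
case E: (ieval (code q) s) => [x1 s1] R fs m0.
have [n [m1 [hn f1 hm1 m10 E1]]] := simulate_instr fs m0 E.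
have [n' [m' [hn' m'0 E2]]] := IH _ _ _ R f1 m10.
exists (n' + (n + 1)), m'; split=> //.
  have : n' <= t * ((m + t.+1).*2 + 5) by apply: leq_trans hn' _; rewrite leq_mul2l; lia.
  by rewrite mulSn; lia.
by rewrite iterD iterD iter1 (step_stay (st' := TSeek q)) // E1.
Qed.

(** The input tape, seen as a track, is a stack with the first letter at its bottom; so
    initialisation only has to mark cell 0. *)
Definition input_store (x : seq letter) : store :=
  fun i => if i == i0 then rev (map emb x) else [::].

Lemma init_tape (x : seq letter) :
  step (tm_init stack_TM x) = tape (input_store x) (maxn 1 (size x)) 0 (TBack start).
Proof.
have E y (u : seq letter) : map (tm_in stack_TM) u =
    map (cell (input_store (y :: u))) (iota 1 (size u)).
  apply: (@eq_from_nth _ (tm_blank stack_TM)); first by rewrite !size_map size_iota.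
  move=> k; rewrite size_map => hk; rewrite (nth_map l0) // (nth_map 0) ?size_iota //.
  rewrite nth_iota // add1n /cell /=; congr (_, _); apply/ffunP => i; rewrite !ffunE /input_store.
  case: eqP => //= _; rewrite revK (nth_map (emb l0)) /= ?size_map //.
  by rewrite (nth_map l0).
case: x => [|y u]; rewrite /tm_init /tape /=.
  congr (_, _, _, _); rewrite /cell; congr (_, _); apply/ffunP=> i.
  by rewrite !ffunE /input_store; case: eqP.
have -> : maxn 1 (size u).+1 - 1 = size u by lia.
rewrite (E y); congr (_, _, _, _); rewrite /cell; congr (_, _); apply/ffunP=> i.
by rewrite !ffunE /input_store; case: eqP; rewrite ?revK.
Qed.

(** The tape initially in use has at most [size x + 1] cells, which turns the 5 of [simulate_frun]
    into 7; the final 2 counts the marking of cell 0 and the writing of the output. Any larger [T]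
    will do because halted configurations are fixed. *)
Lemma stack_TM_runs t x b s' : frun t start (input_store x) = (inr b, s') ->
  forall T, t * ((size x + t).*2 + 7) + 2 <= T -> runs_to stack_TM x (enc_bool b) T.
Proof.
move=> R T hT.
have fs : fits (input_store x) (maxn 1 (size x)).
  by move=> i; rewrite /input_store; case: eqP => // _; rewrite size_rev size_map; lia.
have [n [m' [hn m'0 E]]] := simulate_frun R fs (leq_maxl _ _).
have {}hn : n + 2 <= T.
  apply: leq_trans hT; rewrite leq_add2r; apply: leq_trans hn _; rewrite leq_mul2l; lia.
have Halt c : tm_halt stack_TM (tm_state_of c) -> forall k, iter k step c = c.
  move=> h; elim=> // k /= ->; move: h; rewrite /tm_step.
  by case: c => [[[q l] h'] r] /= ->.
have E2 : iter (n + 2) step (tm_init stack_TM x) =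
   (THalt, [::], (Some (Some b), (cell s' 0).2), map (cell s') (iota 1 (m' - 1))).
  have -> : n + 2 = 1 + (n + 1) by lia.
  rewrite iterD iterD !iter1 init_tape E /=.
  by case: (cell s' 0).
have -> : T = T - (n + 2) + (n + 2) by lia.
rewrite /runs_to iterD E2 Halt // /tm_output /=; split=> //; congr (_ :: _).
case: (m' - 1) => //=.
Qed.
End Flowchart.
End StackMachine.

(** * Structured stack programs and their polynomial-time Hoare logic *)

Section Programs.
Variables (I G : finType).
Local Notation store := (store I G).

(** Continuations and loop bodies are arbitrary functions on finite types: compilation unfolds them
    into one control point per value, so computing on results costs no time. *)
Inductive prog : finType -> Type :=
  | Ret (R : finType) (r : R) : prog R
  | Push (i : I) (a : G) : prog unit
  | Pop (i : I) : prog (option G)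
  | Bind (R1 R2 : finType) (p : prog R1) (f : R1 -> prog R2) : prog R2
  | Iter (S R : finType) (f : S -> prog (S + R)%type) (s : S) : prog R.

Inductive exec : forall R : finType, prog R -> store -> nat -> R -> store -> Prop :=
  | ERet R r s : exec (@Ret R r) s 0 r s
  | EPush i a s : exec (Push i a) s 1 tt (upd s i (a :: s i))
  | EPopN i s : s i = [::] -> exec (Pop i) s 1 None s
  | EPopS i a v s : s i = a :: v -> exec (Pop i) s 1 (Some a) (upd s i v)
  | EBind R1 R2 (p : prog R1) (f : R1 -> prog R2) s t r s1 t' r' s2 :
      exec p s t r s1 -> exec (f r) s1 t' r' s2 -> exec (Bind p f) s (t + t') r' s2
  | EIterR (S R : finType) (f : S -> prog (S + R)%type) x s t r s' :
      exec (f x) s t (inr r) s' -> exec (Iter f x) s t.+1 r s'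
  | EIterL (S R : finType) (f : S -> prog (S + R)%type) x y s t s1 t' r s' :
      exec (f x) s t (inl y) s1 -> exec (Iter f y) s1 t' r s' ->
      exec (Iter f x) s (t + t').+1 r s'.

Fixpoint states (R : finType) (p : prog R) : finType :=
  match p with
  | Ret _ _ => void
  | Push _ _ => unit
  | Pop _ => unit
  | Bind R1 _ p f => (states p + {r : R1 & states (f r)})%type
  | Iter A _ f _ => (A + {s : A & states (f s)})%type
  end.

(** [Ret] compiles to no instruction, so a program may have no first state of its own; its entry is
    then found by passing the result to the continuation [k]. [inj] places the states of [p] inside
    the whole flowchart. *)
Fixpoint entry X (R : finType) (p : prog R) : (R -> X) -> (states p -> X) -> X :=
  match p in prog R return (R -> X) -> (states p -> X) -> X with
  | Ret _ r => fun k _ => k r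
  | Push _ _ => fun _ inj => inj tt
  | Pop _ => fun _ inj => inj tt
  | Bind R1 R2 p f => fun k inj =>
      entry (p := p) (fun r => entry (p := f r) k (fun z => inj (inr (existT _ r z))))
        (fun z => inj (inl z))
  | Iter A R f s => fun _ inj => inj (inl s)
  end.

Definition loopk X (S R : finType) (k : R -> X) (h : S -> X) (v : (S + R)%type) : X :=
  match v with inl s => h s | inr r => k r end.

Fixpoint pcode X (R : finType) (p : prog R) : (R -> X) -> (states p -> X) -> states p -> instr I G X :=
  match p in prog R return (R -> X) -> (states p -> X) -> states p -> instr I G X with
  | Ret _ _ => fun _ _ z => match z with end
  | Push i a => fun k _ _ => IPush i a (k tt)
  | Pop i => fun k _ _ => IPop i k
  | Bind R1 R2 p f => fun k inj z =>
      match z with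
      | inl z => pcode (p := p)
          (fun r => entry (p := f r) k (fun z => inj (inr (existT _ r z))))
          (fun z => inj (inl z)) z
      | inr (existT r z) => pcode (p := f r) k (fun z => inj (inr (existT _ r z))) z
      end
  | Iter A R f _ => fun k inj z =>
      match z with
      | inl s => INop I G (entry (p := f s) (loopk k (fun s => inj (inl s)))
                   (fun z => inj (inr (existT _ s z))))
      | inr (existT s z) => pcode (p := f s) (loopk k (fun s => inj (inl s)))
                   (fun z => inj (inr (existT _ s z))) z
      end
  end.

(** Stated for any flowchart that contains the code of [p] along [inj], and with spare fuel [n], so
    that the induction applies to the parts of a [Bind] and to the body of a loop. *)
Lemma exec_frun (Q : finType) (code : Q -> instr I G (Q + bool)) (R : finType) (p : prog R) s t r s' :
  exec p s t r s' -> forall (k : R -> Q + bool) (inj : states p -> Q),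
  (forall z, code (inj z) = pcode k (fun z => inl (inj z)) z) ->
  forall n, frun code (t + n) (entry k (fun z => inl (inj z))) s = frun code n (k r) s'.
Proof.
elim=> {R p s t r s'}.
- by [].
- by move=> i a s k inj H n; rewrite add1n /= H.
- by move=> i s E k inj H n; rewrite add1n /= H /= E.
- by move=> i a v s E k inj H n; rewrite add1n /= H /= E.
- move=> R1 R2 p f s t r s1 t' r' s2 _ IH1 _ IH2 k inj H n.
  rewrite -addnA (IH1 _ (fun z => inj (inl z))) => [|z]; last by rewrite H.
  by rewrite (IH2 _ (fun z => inj (inr (existT _ r z)))) => [|z]; rewrite ?H.
- move=> S R f x s t r s' _ IH k inj H n.
  by rewrite addSn /= H /= (IH _ (fun z => inj (inr (existT _ x z)))) => [|z]; rewrite ?H.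
- move=> S R f x y s t s1 t' r s' _ IH1 _ IH2 k inj H n.
  rewrite addSn -addnA /= H /= (IH1 _ (fun z => inj (inr (existT _ x z)))) => [|z] /=.
    by rewrite (IH2 k inj).
  by rewrite H.
Qed.

Section Hoare.
Variables (X : Type) (sz : X -> nat).

(* Total correctness with a running time polynomial in the size of the ghost
   parameter. *)
Definition triple (P : X -> store -> Prop) (R : finType) (p : prog R) (Q : X -> R -> store -> Prop) :=
  exists c k, forall x s, P x s ->
    exists t r s', [/\ exec p s t r s', t <= c * (sz x).+1 ^ k & Q x r s'].

Lemma poly_weaken c k c' k' n : c <= c' -> k <= k' -> c * n.+1 ^ k <= c' * n.+1 ^ k'.
Proof. by move=> hc hk; apply: leq_mul => //; apply: leq_pexp2l. Qed.

Lemma tripleRet (P : X -> store -> Prop) (R : finType) (r : R) (Q : X -> R -> store -> Prop) :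
  (forall x s, P x s -> Q x r s) -> triple P (Ret r) Q.
Proof. by move=> H; exists 0, 0 => x s /H h; exists 0, r, s; split=> //; constructor. Qed.

Lemma triplePush (P : X -> store -> Prop) i a (Q : X -> unit -> store -> Prop) :
  (forall x s, P x s -> Q x tt (upd s i (a :: s i))) -> triple P (Push i a) Q.
Proof.
by move=> H; exists 1, 0 => x s /H h; exists 1, tt, (upd s i (a :: s i)); split=> //; constructor.
Qed.

(** Each continuation of a [Bind] comes with its own polynomial; as there are finitely many results,
    the maxima of the coefficients and exponents serve all of them. *)
Lemma poly_uniform (R : finType) (A : R -> nat -> nat -> Prop) :
  (forall r c k c' k', A r c k -> c <= c' -> k <= k' -> A r c' k') ->
  (forall r, exists c k, A r c k) -> exists c k, forall r, A r c k.
Proof.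
move=> mono H.
pose c r := proj1_sig (constructive_indefinite_description _ (H r)).
have Hc r : exists k, A r (c r) k by rewrite /c; case: constructive_indefinite_description.
pose k r := proj1_sig (constructive_indefinite_description _ (Hc r)).
have Hk r : A r (c r) (k r) by rewrite /k; case: constructive_indefinite_description.
exists (\max_r c r), (\max_r k r) => r.
by apply: mono (Hk r) _ _; apply: leq_bigmax.
Qed.

Lemma tripleBind (P : X -> store -> Prop) (R1 R2 : finType) (p : prog R1) (f : R1 -> prog R2) M
    (Q : X -> R2 -> store -> Prop) :
  triple P p M -> (forall r, triple (fun x s => M x r s) (f r) Q) -> triple P (Bind p f) Q.
Proof.
move=> [c1 [k1 H1]] H.
have [r c k c' k' Hr hc hk|c2 [k2 H2]] := poly_uniform _ H.
  move=> x s /Hr [t [r' [s' [E ht q]]]]; exists t, r', s'; split=> //.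
  by apply: leq_trans ht _; apply: poly_weaken.
exists (c1 + c2), (maxn k1 k2) => x s /H1 [t [r [s1 [E ht /H2]]]].
case=> t' [r' [s2 [E' ht' q]]]; exists (t + t'), r', s2; split=> //.
  by apply: EBind E E'.
rewrite mulnDl leq_add //.
  by apply: leq_trans ht _; apply: poly_weaken => //; apply: leq_maxl.
by apply: leq_trans ht' _; apply: poly_weaken => //; apply: leq_maxr.
Qed.

End Hoare.

(** A subroutine is specified with a ghost of its own, often its whole initial store. At a call this
    ghost may be chosen from the current store, provided that its size is polynomial in the
    caller's: polynomials compose. *)
Lemma tripleA X Y (szX : X -> nat) (szY : Y -> nat) (P : X -> store -> Prop)
    (P' : Y -> store -> Prop) (R : finType) (p : prog R) (Q : X -> R -> store -> Prop)
    (Q' : Y -> R -> store -> Prop) c0 k0 :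
  triple szY P' p Q' ->
  (forall x s, P x s -> exists y, [/\ P' y s, szY y <= c0 * (szX x).+1 ^ k0 &
     forall r s', Q' y r s' -> Q x r s']) ->
  triple szX P p Q.
Proof.
move=> [c [k H]] HA; exists (c * (c0 + 1) ^ k), (k0 * k) => x s /HA [y [/H [t [r [s' [E ht q]]]] hy hQ]].
exists t, r, s'; split=> //; last exact: hQ.
apply: leq_trans ht _; rewrite -mulnA leq_mul2l; apply/orP; right.
rewrite expnM -expnMn; case: k {H} => // k; rewrite leq_exp2r //.
have : 0 < (szX x).+1 ^ k0 by rewrite expn_gt0.
by rewrite mulnDl; lia.
Qed.

Lemma tripleC X (sz : X -> nat) (P P' : X -> store -> Prop) (R : finType) (p : prog R)
    (Q Q' : X -> R -> store -> Prop) :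
  triple sz P' p Q' -> (forall x s, P x s -> P' x s) ->
  (forall x r s, Q' x r s -> Q x r s) -> triple sz P p Q.
Proof.
move=> [c [k H]] hP hQ; exists c, k => x s /hP /H [t [r [s' [E ht q]]]].
by exists t, r, s'; split=> //; apply: hQ.
Qed.

(** The variant [m] is part of the ghost of the body but does not enter its size. The cost of a
    round is therefore bounded uniformly, and the total is a product of two polynomials. *)
Lemma tripleIter X (sz : X -> nat) (P : X -> store -> Prop) (S R : finType)
   (f : S -> prog (S + R)%type) (s0 : S) (Q : X -> R -> store -> Prop)
   (Inv : X -> nat -> S -> store -> Prop) c0 k0 :
  (forall x s, P x s -> exists2 m, m <= c0 * (sz x).+1 ^ k0 & Inv x m s0 s) ->
  (forall a, triple (fun y : X * nat => sz y.1) (fun y s => Inv y.1 y.2 a s) (f a)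
     (fun y v s => match v with
        | inl b => exists2 m, m < y.2 & Inv y.1 m b s
        | inr r => Q y.1 r s end)) ->
  triple sz P (Iter f s0) Q.
Proof.
move=> HP H.
have [r c k c' k' Hr hc hk|c [k {}H]] := poly_uniform _ H.
  move=> x s /Hr [t [r' [s' [E ht q]]]]; exists t, r', s'; split=> //.
  by apply: leq_trans ht _; apply: poly_weaken.
have L m : forall x a s, Inv x m a s -> exists t r s',
    [/\ exec (Iter f a) s t r s', t <= m.+1 * (c * (sz x).+1 ^ k).+1 & Q x r s'].
  elim/ltn_ind: m => m IH x a s /(H a (x, m)) [t [[b|r] [s1 [E ht]]]] /= => [[m' lm Iv]|q].
    have [t' [r [s' [E' ht' q]]]] := IH m' lm _ _ _ Iv.
    exists (t + t').+1, r, s'; split=> //; first exact: EIterL E E'.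
    have : t' <= m * (c * (sz x).+1 ^ k).+1.
      by apply: leq_trans ht' _; rewrite leq_mul2r; lia.
    by rewrite mulSn /= in ht *; lia.
  exists t.+1, r, s1; split=> //; first exact: EIterR.
  by rewrite mulSn /= in ht *; lia.
exists ((c0 + 1) * (c + 1)), (k0 + k) => x s /HP [m hm /L [t [r [s' [E ht q]]]]].
exists t, r, s'; split=> //; apply: leq_trans ht _.
rewrite expnD mulnACA; apply: leq_mul.
  have : 0 < (sz x).+1 ^ k0 by rewrite expn_gt0.
  by rewrite mulnDl; lia.
have : 0 < (sz x).+1 ^ k by rewrite expn_gt0.
by rewrite mulnDl; lia.
Qed.

End Programs.

Theorem compile_decider (I G : finType) (i0 : I) (emb : letter -> G) (X : Type)
    (dom : X -> Prop) (enc : X -> seq letter) (P : X -> Prop) (p : prog I G bool) :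
  triple (fun x => size (enc x)) (fun x s => dom x /\ s = input_store i0 emb (enc x)) p
    (fun x b _ => b <-> P x) ->
  poly_decidable dom enc P.
Proof.
case=> c [k H].
pose M := stack_TM (pcode (p := p) inr inl) (entry (p := p) inr inl) i0 emb.
(* With [t <= c * n.+1 ^ k] instructions the machine needs on the order of [t * (n + t)] steps, of
   degree [k + k.+1]. The factor [2 ^ K] in [c'] trades [n.+1 ^ K] for [n ^ K + 1], the form used by
   [poly_decidable]. *)
pose K := k + k.+1.
pose c' := (c * (c.*2 + 9) + 2) * 2 ^ K.
exists M, c', K => x dx.
have [t [b [s' [E ht hb]]]] := H x _ (conj dx erefl).
exists b; split=> //.
have R := @exec_frun _ _ _ (pcode (p := p) inr inl) _ _ _ _ _ _ E inr id (fun z => erefl) 0.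
rewrite addn0 /= in R.
have {}R : frun (pcode (p := p) inr inl) t (entry (p := p) inr inl) (input_store i0 emb (enc x)) = (inr b, s').
  by rewrite R.
apply: (stack_TM_runs R).
set n := size (enc x) in ht *.
have hK : n.+1 ^ K <= 2 ^ K * (n ^ K + 1).
  case: (posnP n) => [->|n0]; first by rewrite exp1n muln_gt0 expn_gt0 addn1.
  apply: leq_trans (_ : (2 * n) ^ K <= _); first by rewrite leq_exp2r ?addnS //; lia.
  by rewrite expnMn leq_mul2l; lia.
have le1 e : 0 < n.+1 ^ e by rewrite expn_gt0.
apply: leq_trans (_ : (c * (c.*2 + 9) + 2) * n.+1 ^ K <= _); last first.
  by rewrite /c' -[X in _ <= _ + X]muln1 -mulnDr -mulnA leq_mul2l hK orbT.
rewrite mulnDl leq_add //; last by rewrite leq_pmulr.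
rewrite /K expnD mulnACA; apply: leq_mul => //.
have hk : n.+1 ^ k <= n.+1 ^ k.+1 by apply: leq_pexp2l.
have hn : n.+1 <= n.+1 ^ k.+1 by rewrite -[X in X <= _]expn1 leq_pexp2l.
have : c * n.+1 ^ k <= c * n.+1 ^ k.+1 by rewrite leq_mul2l hk orbT.
by rewrite mulnDl -doubleMl; lia.
Qed.

(** * Passes over a stack of columns *)

Section Straight.
Variables (I G : finType).
Local Notation store := (store I G).

(** Loop-free code, in particular the body of a loop, is verified by plain evaluation; loops
    evaluate to [None] and are left to [tripleIter]. *)
Fixpoint eval (R : finType) (p : prog I G R) (s : store) : option (R * store) :=
  match p in prog _ _ R return option (R * store) with
  | Ret _ r => Some (r, s)
  | Push i a => Some (tt, upd s i (a :: s i))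
  | Pop i => Some (if s i is a :: v then (Some a, upd s i v) else (None, s))
  | Bind R1 R2 p f => if eval p s is Some (r, s') then eval (f r) s' else None
  | Iter _ _ _ _ => None
  end.

Fixpoint depth (R : finType) (p : prog I G R) : nat :=
  match p with
  | Bind R1 R2 p f => depth p + \max_r depth (f r)
  | _ => 1
  end.

Local Notation prog := (prog I G).

Lemma eval_exec (R : finType) (p : prog R) s r s' : eval p s = Some (r, s') ->
  exists2 t, t <= depth p & exec p s t r s'.
Proof.
elim: p s r s' => {R} [R r0|i a|i|R1 R2 p IHp f IHf|A R f _ a] s r s' //=.
- by case=> -> ->; exists 0 => //; constructor.
- by case: r => -[<-]; exists 1 => //; constructor.
- by case E: (s i) => [|a v] [<- <-]; exists 1 => //; constructor.
- case E: (eval p s) => [[r1 s1]|] // E'.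
  have [t ht Et] := IHp _ _ _ E; have [t' ht' Et'] := IHf _ _ _ _ E'.
  exists (t + t'); last exact: EBind Et Et'.
  by apply: leq_add => //; apply: leq_trans ht' _; apply: (leq_bigmax r1).
Qed.

Lemma tripleE X (sz : X -> nat) (P : X -> store -> Prop) (R : finType) (p : prog R)
    (Q : X -> R -> store -> Prop) :
  (forall x s, P x s -> if eval p s is Some (r, s') then Q x r s' else False) ->
  triple sz P p Q.
Proof.
move=> H; exists (depth p), 0 => x s /H; case E: (eval p s) => [[r s']|] // q.
by have [t ht Et] := eval_exec E; exists t, r, s'; rewrite muln1.
Qed.

Lemma upd_eq (s : store) i v : upd s i v i = v. Proof. by rewrite /upd eqxx. Qed.

Lemma upd_ne (s : store) i v k : k != i -> upd s i v k = s k.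
Proof. by rewrite /upd => /negbTE ->. Qed.

Lemma upd_id (s : store) i v : s i = v -> upd s i v = s.
Proof. by move=> <-; apply: functional_extensionality => k; rewrite /upd; case: eqP => // ->. Qed.

Section Moves.
Variables (a b c : I) (f g : G -> G).
Hypotheses (ab : a != b) (ac : a != c) (bc : b != c).

Definition drain : prog unit :=
  Iter (fun _ : unit => Bind (Pop G a) (fun o => if o is Some x then
      Bind (Push b x) (fun _ => Ret I G (inl tt : unit + unit)%type)
    else Ret I G (inr tt : unit + unit)%type)) tt.

Lemma drainP : triple (fun y : store => size (y a)) (fun y s => s = y) drain
  (fun y _ s => s = upd (upd y a [::]) b (catrev (y a) (y b))).
Proof.
have ba : b != a by rewrite eq_sym.
apply: (@tripleIter _ _ _ _ _ _ _ _ _ _ (fun y m (_ : unit) s => exists u v,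
   [/\ m = size u, s = upd (upd y a u) b v & catrev u v = catrev (y a) (y b)]) 1 1).
  move=> y s ->; exists (size (y a)); first by rewrite mul1n expn1.
  by exists (y a), (y b); split=> //; rewrite !upd_id.
move=> [] ; apply: tripleE => -[y m] s [u [v [/= -> -> E]]] /=.
rewrite upd_ne // upd_eq; case: u E => [|x u] /= E; first by rewrite -E.
exists (size u) => //; exists u, (x :: v); split=> //.
by apply: functional_extensionality => k; rewrite /upd (negbTE ba) eqxx; case: (k == a); case: (k == b).
Qed.

Definition distribute : prog unit :=
  Iter (fun _ : unit => Bind (Pop G a) (fun o => if o is Some x then
      Bind (Push b (f x)) (fun _ => Bind (Push c (g x)) (fun _ =>
      Ret I G (inl tt : unit + unit)%type))
    else Ret I G (inr tt : unit + unit)%type)) tt.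

Lemma distributeP : triple (fun y : store => size (y a)) (fun y s => s = y) distribute
  (fun y _ s => s = upd (upd (upd y a [::]) b (catrev (map f (y a)) (y b)))
                    c (catrev (map g (y a)) (y c))).
Proof.
apply: (@tripleIter _ _ _ _ _ _ _ _ _ _ (fun y m (_ : unit) s => exists u v w,
   [/\ m = size u, s = upd (upd (upd y a u) b v) c w,
    catrev (map f u) v = catrev (map f (y a)) (y b) &
    catrev (map g u) w = catrev (map g (y a)) (y c)]) 1 1).
  move=> y s ->; exists (size (y a)); first by rewrite mul1n expn1.
  by exists (y a), (y b), (y c); split=> //; rewrite !upd_id.
move=> [] ; apply: tripleE => -[y m] s [u [v [w [/= -> -> E1 E2]]]] /=.
rewrite upd_ne // upd_ne // upd_eq; case: u E1 E2 => [|x u] /= E1 E2; first by rewrite -E1 -E2.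
exists (size u) => //; exists u, (f x :: v), (g x :: w); split=> //.
have [ba ca cb] : [/\ b != a, c != a & c != b] by split; rewrite eq_sym.
apply: functional_extensionality => k.
by rewrite /upd (negbTE ba) (negbTE bc) (negbTE ca) (negbTE cb) !eqxx; case: (k == a); case: (k == b); case: (k == c).
Qed.

End Moves.

Definition bit_letter (b : bool) : letter := if b then l1 else l0.
Definition letter_bit (a : letter) : option bool :=
  if a == l1 then Some true else if a == l0 then Some false else None.

Section Transduction.
Variables (col S : finType) (c0 : col).
Variables (delta : S -> bool -> col -> S * col) (fin : S -> option col).

Fixpoint transduce (st : S) (ws : seq (bool * col)) : S * seq col :=
  if ws is w :: ws' then
    let d := delta st w.1 w.2 in
    let r := transduce d.1 ws' in (r.1, d.2 :: r.2)
  else (st, if fin st is Some d then [:: d] else [::]).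

(** The shorter side is continued by zeros, so a pass becomes the run of an automaton on pairs; a
    number longer than the table lengthens the table. *)
Fixpoint pad (u : seq bool) (cs : seq col) : seq (bool * col) :=
  if u is b :: u' then (b, head c0 cs) :: pad u' (behead cs) else map (pair false) cs.

Lemma size_pad u cs : size (pad u cs) <= size u + size cs.
Proof.
elim: u cs => [|b u IH] cs /=; first by rewrite size_map.
by have := IH (behead cs); rewrite size_behead; lia.
Qed.

Lemma size_transduce st ws : size (transduce st ws).2 <= (size ws).+1.
Proof.
by elim: ws st => [|w ws IH] st /=; [case: fin | rewrite ltnS].
Qed.

End Transduction.

Section Transducer.
Variables (col S : finType) (c0 : col).
Variables (embL : letter -> G) (decL : G -> option letter).
Variables (embC : col -> G) (decC : G -> option col).
Hypotheses (embLK : pcancel embL decL) (embCK : pcancel embC decC).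
Variables (A K Tm L : I).
Hypothesis uAKTL : uniq [:: A; K; Tm; L].
Variables (delta : S -> bool -> col -> S * col) (fin : S -> option col).

(** [z.2] tells whether the number is still being read. The separator makes [bt] equal to [None],
    which clears the flag, so no letter of the next number is consumed while the remaining columns
    are processed. *)
Definition pass_body (z : S * bool) : prog ((S * bool) + S)%type :=
  Bind (if z.2 then Pop G A else Ret I G None) (fun o =>
  Bind (if o is Some x then Push L x else Ret I G tt) (fun _ =>
  Bind (Pop G K) (fun c =>
    let bt := obind letter_bit (obind decL o) in
    let cc := obind decC c in
    if (bt == None) && (cc == None) then
      Bind (if fin z.1 is Some d then Push Tm (embC d) else Ret I G tt)
        (fun _ => Ret I G (inr z.1 : (S * bool) + S)%type)
    else
      let d := delta z.1 (odflt false bt) (odflt c0 cc) in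
      Bind (Push Tm (embC d.2)) (fun _ =>
        Ret I G (inl (d.1, bt != None) : (S * bool) + S)%type)))).

(* Reads a number (little endian) from stack [A] in lockstep with the columns on
   stack [K], rewriting the latter; [L] logs the letters read. *)
Definition pass (st : S) : prog S :=
  Bind (Iter pass_body (st, true)) (fun r => Bind (drain Tm K) (fun _ => Ret I G r)).

Definition num_code (u : seq bool) : seq G := map embL (rcons (map bit_letter u) lsep).

Definition pass_ghost := (store * seq bool * seq G * seq col)%type.

Lemma passP st : triple (fun y : pass_ghost => size y.1.1.2 + size y.2)
  (fun '(s0, u, rest, cs) s => [/\ s = s0, s A = num_code u ++ rest,
     s K = map embC cs & s Tm = [::]])
  (pass st)
  (fun '(s0, u, rest, cs) r s => let F := transduce delta fin st (pad c0 u cs) in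
     r = F.1 /\ s = upd (upd (upd s0 A rest) K (map embC F.2)) L
                     (catrev (num_code u) (s0 L))).
Proof.
have : [/\ [/\ A != K, A != Tm & A != L], K != A, K != Tm & [/\ K != L, Tm != A, Tm != K &
  [/\ Tm != L, L != A, L != K & L != Tm]]].
  move: uAKTL; rewrite /= !inE !negb_or => /and4P[/and3P[h1 h2 h3] /andP[h4 h5] h6 _].
  by do !split => //; rewrite eq_sym.
case=> -[AK AT AL] KA KT [KL TA TK [TL LA LK LT]].
(* The columns written so far, reversed on the scratch stack, followed by the transduction of what
   remains, always give the complete transduction [F]. The summand [z.2] of the variant pays for the
   separator. *)
pose inv (y : pass_ghost) m (z : S * bool) s := exists u cs tm lg,
  let: (s0, u0, rest, cs0) := y in
  let F := transduce delta fin st (pad c0 u0 cs0) in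
  [/\ m = size u + size cs + z.2,
     s = upd (upd (upd (upd s0 A (if z.2 then num_code u ++ rest else rest))
            K (map embC cs)) Tm (map embC tm)) L lg,
     ~~ z.2 -> u = [::],
     (transduce delta fin z.1 (pad c0 u cs)).1 = F.1 /\
       catrev tm (transduce delta fin z.1 (pad c0 u cs)).2 = F.2 &
     catrev (if z.2 then num_code u else [::]) lg = catrev (num_code u0) (s0 L) /\ s0 Tm = [::]].
apply: (tripleBind (M := fun '(s0, u, rest, cs) r s =>
     let F := transduce delta fin st (pad c0 u cs) in
     [/\ r = F.1, s0 Tm = [::] & s = upd (upd (upd (upd s0 A rest) K [::])
         Tm (map embC (rev F.2))) L (catrev (num_code u) (s0 L))])).
  apply: (@tripleIter _ _ _ _ _ _ _ _ _ _ inv 2 1).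
    move=> [[[s0 u] rest] cs] s [-> EA EK ET] /=; exists (size u + size cs + 1).
      by rewrite expn1 mul2n -addnn addn1 leq_addr.
    exists u, cs, [::], (s0 L); split=> //.
    by rewrite -EA -EK; do 4!rewrite upd_id ?upd_ne //.
  move=> [st1 rd]; apply: tripleE => -[[[[s0 u0] rest] cs0] m] s [u [cs [tm [lg]]]].
  case=> /= -> -> hu [E1 E2] [E3 ET].
  set F := transduce delta fin st (pad c0 u0 cs0) in E1 E2 *.
  have UE := (fun s v => @upd_ne s _ v _ AK, fun s v => @upd_ne s _ v _ AT,
    fun s v => @upd_ne s _ v _ AL, fun s v => @upd_ne s _ v _ KA, fun s v => @upd_ne s _ v _ KT,
    fun s v => @upd_ne s _ v _ KL, fun s v => @upd_ne s _ v _ TA, fun s v => @upd_ne s _ v _ TK,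
    fun s v => @upd_ne s _ v _ TL, fun s v => @upd_ne s _ v _ LA, fun s v => @upd_ne s _ v _ LK,
    fun s v => @upd_ne s _ v _ LT, upd_eq).
  have fe (s1 s2 : store) : s1 A = s2 A -> s1 K = s2 K -> s1 Tm = s2 Tm -> s1 L = s2 L ->
     (forall k, k != A -> k != K -> k != Tm -> k != L -> s1 k = s2 k) -> s1 = s2.
    move=> hA hK hT hL h; apply: functional_extensionality => k.
    case: (eqVneq k A) => [->//|kA]; case: (eqVneq k K) => [->//|kK].
    by case: (eqVneq k Tm) => [->//|kT]; case: (eqVneq k L) => [->//|kL]; apply: h.
  have ft (s1 s2 : store) : (s1 A, s1 K, s1 Tm, s1 L) = (s2 A, s2 K, s2 Tm, s2 L) ->
     (forall k, k != A -> k != K -> k != Tm -> k != L -> s1 k = s2 k) -> s1 = s2.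
    by case=> *; apply: fe.
  case: rd hu E3 => /= [_|/(_ isT) hu] E3.
    case: u E1 E2 E3 => [|b u] E1 E2 E3.
      rewrite /num_code /= !UE /= !UE; case: cs E1 E2 => [|c cs] /= E1 E2.
        rewrite embLK /=; case Ef: (fin st1) E2 => [d|] /= E2; split=> //; apply: ft => [|k k1 k2 k3 k4].
        - by rewrite !UE -E3 -E2 /= catrevE rev_cat revK.
        - by rewrite !upd_ne.
        - by rewrite !UE -E3 -E2 /= catrevE cats0 revK.
        - by rewrite !upd_ne.
      rewrite embLK embCK /=; exists (size cs + 0); first by clear; lia.
      exists [::], cs, ((delta st1 false c).2 :: tm), (embL lsep :: lg); split=> //.
      by apply: ft => [|k k1 k2 k3 k4]; rewrite ?UE // !upd_ne.
    rewrite /num_code /= !UE /= !UE embLK /=.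
    have -> : letter_bit (bit_letter b) = Some b by case: b {E1 E2 E3}.
    case: cs E1 E2 => [|c cs] /= E1 E2.
      exists (size u + 0 + 1); first by clear; lia.
      exists u, [::], ((delta st1 b c0).2 :: tm), (embL (bit_letter b) :: lg); split=> //=.
      by apply: ft => [|k k1 k2 k3 k4]; rewrite ?UE // !upd_ne.
    rewrite embCK /=; exists (size u + size cs + 1); first by clear; lia.
    exists u, cs, ((delta st1 b c).2 :: tm), (embL (bit_letter b) :: lg); split=> //=.
    by apply: ft => [|k k1 k2 k3 k4]; rewrite ?UE // !upd_ne.
  move: E1 E2; rewrite hu /= !UE; case: cs => [|c cs] /= E1 E2.
    case Ef: (fin st1) E2 => [d|] /= E2; split=> //; apply: ft => [|k k1 k2 k3 k4].
    - by rewrite !UE -E3 -E2 /= catrevE rev_cat revK.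
    - by rewrite !upd_ne.
    - by rewrite !UE -E3 -E2 /= catrevE cats0 revK.
    - by rewrite !upd_ne.
  rewrite embCK /=; exists (size cs + 0); first by clear; lia.
  exists [::], cs, ((delta st1 false c).2 :: tm), lg; split=> //.
  by apply: ft => [|k k1 k2 k3 k4]; rewrite ?UE // !upd_ne.
move=> r; apply: (tripleBind (M := fun '(s0, u, rest, cs) (_ : unit) s =>
     let F := transduce delta fin st (pad c0 u cs) in
     [/\ r = F.1, s0 Tm = [::] & s = upd (upd (upd (upd s0 A rest) K (map embC F.2))
         Tm [::]) L (catrev (num_code u) (s0 L))])).
  apply: (tripleA (c0 := 1) (k0 := 1) (drainP TK)).
  move=> [[[s0 u] rest] cs] s [-> ET ->]; eexists; split; first by [].
    rewrite mul1n expn1 upd_ne // upd_eq size_map size_rev /=.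
    by apply: leq_trans (size_transduce _ _ _ _) _; rewrite ltnS size_pad.
  move=> _ s' ->; split=> //; apply: functional_extensionality => k.
  rewrite /upd eqxx (negbTE KT) (negbTE KL) (negbTE TL) eqxx catrevE cats0 -map_rev revK.
  case: (eqVneq k K) => [->|_]; first by rewrite (negbTE KT) (negbTE KL).
  by case: (eqVneq k Tm) => [->|_]; rewrite ?(negbTE TL).
move=> w; apply: tripleE => -[[[s0 u] rest] cs] s [-> ET ->]; split=> //.
apply: functional_extensionality => k; rewrite /upd.
by case: (eqVneq k Tm) => [->|_ //]; rewrite (negbTE TL) (negbTE TK) (negbTE TA).
Qed.
End Transducer.
End Straight.

(** * Simulation of a Turing machine by a stack program *)

Section TMFacts.
Variable M : TM.

Lemma tm_step_halted (c : cfg M) : tm_halt M (tm_state_of c) -> tm_step c = c.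
Proof. by case: c => [[[q l] h] r] /= ->. Qed.

Lemma iter_halted (c : cfg M) k : tm_halt M (tm_state_of c) -> iter k (@tm_step M) c = c.
Proof. by move=> h; elim: k => //= k ->; apply: tm_step_halted. Qed.

Definition cfg_size (c : cfg M) : nat := let: (_, _, _, r) := c in (size r).+1.

Lemma cfg_size_step c : cfg_size (tm_step c) <= (cfg_size c).+1.
Proof.
case: c => [[[q l] h] r] /=; case: ifP => // _; case: tm_delta => [[q' a] []] /=;
  by [case: l|case: r => [|? ?] //=; lia|].
Qed.

Lemma cfg_size_iter x k : cfg_size (iter k (@tm_step M) (tm_init M x)) <= size x + k + 1.
Proof.
elim: k => [|k IH]; first by case: x => [|a x] //=; rewrite size_map; lia.
by apply: leq_trans (cfg_size_step _) _; move: IH; rewrite !addn1 addnS.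
Qed.

(** This bounds the tie-breaking lists, which later passes must read within polynomial time. *)
Lemma runs_to_size x out t : runs_to M x out t -> size out <= size x + t + 1.
Proof.
case=> _ <-; apply: leq_trans (cfg_size_iter x t); case: (iter _ _ _) => [[[q l] h] r].
have R (s : seq (tm_sym M)) : size (read_out s) <= size s.
  by elim: s => //= a s IH; case: tm_out.
exact: (R (h :: r)).
Qed.
End TMFacts.

Section Simulator.
Variables (I G : finType) (M : TM).
Local Notation store := (store I G).
Local Notation prog := (prog I G).
Variables (emb : tm_sym M -> G) (dec : G -> option (tm_sym M)) (embL : letter -> G).
Hypothesis embK : pcancel emb dec.
Variables (Lt Rt O : I).
Hypothesis uLRO : uniq [:: Lt; Rt; O].

Let sy (o : option G) := odflt (tm_blank M) (obind dec o).

Definition sim_body (q : tm_state M) : prog (tm_state M + unit)%type :=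
  if tm_halt M q then Ret I G (inr tt : tm_state M + unit)%type else
  Bind (Pop G Rt) (fun o =>
    let: (q', a, m) := tm_delta M q (sy o) in
    let next := Ret I G (inl q' : tm_state M + unit)%type in
    match m with
    | MStay => Bind (Push Rt (emb a)) (fun _ => next)
    | MLeft => Bind (Push Rt (emb a)) (fun _ => Bind (Pop G Lt) (fun o =>
                 Bind (Push Rt (emb (sy o))) (fun _ => next)))
    | MRight => Bind (Push Lt (emb a)) (fun _ => Bind (Pop G Rt) (fun o =>
                 Bind (Push Rt (emb (sy o))) (fun _ => next)))
    end).

Definition out_body (_ : unit) : prog (unit + unit)%type :=
  Bind (Pop G Rt) (fun o =>
    if obind (tm_out M) (obind dec o) is Some a then
      Bind (Push O (embL a)) (fun _ => Ret I G (inl tt : unit + unit)%type)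
    else Ret I G (inr tt : unit + unit)%type).

(** The initial pop and push put a blank under the head when the input is empty, so that [Rt] always
    starts with the head cell. *)
Definition simulate : prog unit :=
  Bind (Pop G Rt) (fun o => Bind (Push Rt (emb (sy o))) (fun _ =>
  Bind (Iter sim_body (tm_start M)) (fun _ => Iter out_body tt))).

Definition sim_ghost := (store * seq letter * seq letter * nat)%type.

Let frame (s0 s : store) := forall k, k \notin [:: Lt; Rt; O] -> s k = s0 k.

Let holds_cfg (s : store) (c : cfg M) := let: (_, l, h, r) := c in
  [/\ s Lt = map emb l, s Rt = map emb (h :: r) & s O = [::]].

Lemma simulateP : triple (fun y : sim_ghost => size y.1.1.2 + y.2)
  (fun '(s0, x, out, t) s => [/\ s = s0, runs_to M x out t,
     s Rt = map (fun a => emb (tm_in M a)) x, s Lt = [::] & s O = [::]])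
  simulate
  (fun '(s0, x, out, t) _ s => s O = rev (map embL out) /\ frame s0 s).
Proof.
have : [/\ Lt != Rt, Lt != O, Rt != O & [/\ Rt != Lt, O != Lt & O != Rt]].
  move: uLRO; rewrite /= !inE !negb_or => /and3P[/andP[h1 h2] h3 _].
  by rewrite [Rt == Lt]eq_sym [O == Lt]eq_sym [O == Rt]eq_sym h1 h2 h3.
case=> LR LO RO [RL OL OR].
have UE := (fun s v => @upd_ne I G s _ v _ LR, fun s v => @upd_ne I G s _ v _ LO,
  fun s v => @upd_ne I G s _ v _ RO, fun s v => @upd_ne I G s _ v _ RL,
  fun s v => @upd_ne I G s _ v _ OL, fun s v => @upd_ne I G s _ v _ OR, @upd_eq I G).
have FU s0 s k v : k \in [:: Lt; Rt; O] -> frame s0 s -> frame s0 (upd s k v).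
  by move=> hk H j hj; rewrite upd_ne ?H //; apply: contraNneq hj => ->.
have [hL hR hO] : [/\ Lt \in [:: Lt; Rt; O], Rt \in [:: Lt; Rt; O] & O \in [:: Lt; Rt; O]].
  by rewrite !inE !eqxx !orbT.
have FR s0 : frame s0 s0 by [].
pose mid (y : sim_ghost) (s : store) (i : nat) := let: (s0, x, out, t) := y in
  [/\ runs_to M x out t, frame s0 s & holds_cfg s (iter i (@tm_step M) (tm_init M x))].
apply: (tripleBind (M := fun (y : sim_ghost) o s => let: (s0, x, out, t) := y in
   mid y (upd s Rt (emb (sy o) :: s Rt)) 0)).
  apply: tripleE => -[[[s0 x] out] t] s [-> R ER EL EO] /=.
  rewrite ER /tm_init; case: x R ER => [|a x] R ER /=; (split; [by []|by do ?[exact: FR | apply: (FU _ _ _ _ hL) | apply: (FU _ _ _ _ hR)]|]);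
    rewrite ?UE ?ER ?EL ?EO /= /sy ?embK //= ?UE ?EL ?EO -?map_comp ?embK //.
move=> o; apply: (tripleBind (M := fun y (_ : unit) s => mid y s 0)).
  by apply: triplePush => -[[[s0 x] out] t] s H.
move=> w; apply: (tripleBind (M := fun (y : sim_ghost) (_ : unit) s =>
    let: (s0, x, out, t) := y in exists2 i, mid y s i & 
      i <= t /\ tm_halt M (tm_state_of (iter i (@tm_step M) (tm_init M x))))).
  apply: (@tripleIter _ _ _ _ _ _ _ _ _ _ (fun (y : sim_ghost) m q s => exists i,
     let: (s0, x, out, t) := y in
     [/\ m = t - i, i <= t, mid y s i & tm_state_of (iter i (@tm_step M) (tm_init M x)) = q]) 1 1).
    move=> [[[s0 x] out] t] s H; exists t; first by rewrite mul1n expn1 /=; clear; lia.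
    by exists 0; split; rewrite ?subn0 //=; case: x {H}.
  move=> q; apply: tripleE => -[[[[s0 x] out] t] m] s [i /= [-> hi [R F C] Eq]].
  rewrite /sim_body; case: ifP => hq /=.
    by exists i => //; rewrite Eq.
  have it : i < t.
    rewrite ltn_neqAle hi andbT; apply/eqP => eit; move: R => [].
    by rewrite -eit Eq hq.
  case Ec: (iter i _ _) C Eq => [[[q0 l] h] r] /= [C1 C2 C3] Eq0; subst q0.
  rewrite C2 /= /sy /= embK /=.
  case Ed: (tm_delta M q h) => [[q' a] mv] /=.
  case: mv Ed => Ed /=.
  - rewrite !UE C1; case: l C1 Ec => [|b l] C1 Ec /=; rewrite ?embK;
    (exists (t - i.+1); first by clear -it; lia); exists i.+1; rewrite /mid !iterS Ec /= hq Ed /=;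
    (split=> //; split=> //); 
    try by do ?[exact: F | apply: (FU _ _ _ _ hL) | apply: (FU _ _ _ _ hR)];
    by rewrite ?UE ?C1 ?C3.
  - rewrite !UE /=; case: r C2 Ec => [|b r] C2 Ec /=; rewrite ?embK;
    (exists (t - i.+1); first by clear -it; lia); exists i.+1; rewrite /mid !iterS Ec /= hq Ed /=;
    (split=> //; split=> //); 
    try by do ?[exact: F | apply: (FU _ _ _ _ hL) | apply: (FU _ _ _ _ hR)];
    by rewrite ?UE ?C1 ?C3.
  - exists (t - i.+1); first by clear -it; lia.
    exists i.+1; rewrite /mid !iterS Ec /= hq Ed /=.
    (split=> //; split=> //); 
    try by do ?[exact: F | apply: (FU _ _ _ _ hL) | apply: (FU _ _ _ _ hR)];
    by rewrite ?UE ?C1 ?C3.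
move=> w' {o w w'}.
apply: (@tripleIter _ _ _ _ _ _ _ _ _ _ (fun (y : sim_ghost) m (_ : unit) s =>
  let: (s0, x, out, t) := y in exists r o, [/\ m = size r, frame s0 s, s Rt = map emb r,
    s O = map embL o & catrev o (read_out r) = out]) 1 1).
  move=> [[[s0 x] out] t] s [i [R F C] [hi hh]].
  (* The loop stops as soon as the machine halts, possibly before time [t]; the configuration no
     longer changes, so the output is the one prescribed at time [t]. *)
  have Et : iter t (@tm_step M) (tm_init M x) = iter i (@tm_step M) (tm_init M x).
    by rewrite -(subnK hi) iterD iter_halted.
  have sz : cfg_size (iter i (@tm_step M) (tm_init M x)) <= size x + i + 1 by apply: cfg_size_iter.
  move: R => []; rewrite Et; move: C sz; case: (iter i _ _) => [[[q l] h] r].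
  move=> [C1 C2 C3] sz _ <-; exists (size (h :: r)); first by rewrite mul1n expn1 /= in sz *; clear -sz hi; lia.
  by exists (h :: r), [::].
case; apply: tripleE => -[[[[s0 x] out] t] m] s /= [r [o [-> F ER EO E]]].
case: r ER E => [|h r] /= -> E /=; first by rewrite EO -E catrevE cats0 map_rev revK.
rewrite embK /=; case: (tm_out M h) E => [a|] E /=.
  exists (size r) => //; exists r, (a :: o); split=> //; rewrite ?UE ?EO //.
  by do ?[exact: F | apply: (FU _ _ _ _ hO) | apply: (FU _ _ _ _ hR)].
by rewrite upd_ne // EO -E catrevE cats0 map_rev revK; split=> //; apply: FU.
Qed.

End Simulator.

(** * Arithmetic on columns *)

Definition bits_val (u : seq bool) : nat := foldr (fun (b : bool) n => b + n.*2) 0 u.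

Lemma bits_val_bin f n : n <= f -> bits_val (bin f n) = n.
Proof.
elim: f n => [|f IH] n /=; first by case: n.
case: eqP => [-> //|n0] nf /=; rewrite IH ?odd_double_half //.
by have := odd_double_half n; lia.
Qed.

Section Columns.
Variable T : finType.
Local Notation col := {ffun T -> bool}.
Local Notation c0 := ([ffun => false] : col).

Definition column_val (cs : seq col) (x : T) : nat :=
  foldr (fun (c : col) n => c x + n.*2) 0 cs.

Section Add.
Variable mask : pred T.

Definition add_delta (k : col) (b : bool) (c : col) : col * col :=
  ([ffun x => [|| c x && k x, c x && (b && mask x) | k x && (b && mask x)]],
   [ffun x => c x (+) k x (+) (b && mask x)]).

(** The transducer state holds the carries of all registers, which are added to in parallel; the
    final map [Some] writes the last carries as a new most significant column, so nothing
    overflows. *)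
Lemma add_val k u cs x :
  column_val (transduce add_delta Some k (pad c0 u cs)).2 x =
  column_val cs x + (if mask x then bits_val u else 0) + k x.
Proof.
elim: u k cs => [|b u IH] k cs /=.
  elim: cs k => [|c cs IH] k /=; first by case: ifP; case: (k x).
  by rewrite IH !ffunE /=; case: ifP; case: (c x); case: (k x) => /= *; lia.
rewrite IH !ffunE; case: cs => [|c cs] /=; rewrite ?ffunE.
  by case: ifP; case: b; case: (k x) => /= *; lia.
by case: ifP; case: b; case: (k x); case: (c x) => /= *; lia.
Qed.
End Add.

Definition match_delta (f : col) (b : bool) (c : col) : col * col :=
  ([ffun x => f x && (c x == b)], c).

Lemma match_val f u cs x :
  column_val (transduce match_delta (fun _ => None) f (pad c0 u cs)).2 x = column_val cs x.
Proof.
elim: u f cs => [|b u IH] f cs /=; first by elim: cs f => //= c cs IH f; rewrite IH.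
by rewrite IH; case: cs => [|c cs] /=; rewrite ?ffunE.
Qed.

Lemma match_flag f u cs x :
  (transduce match_delta (fun _ => None) f (pad c0 u cs)).1 x =
  f x && (column_val cs x == bits_val u).
Proof.
elim: u f cs => [|b u IH] f cs /=.
  elim: cs f => [|c cs IH] f /=; first by rewrite andbT.
  by rewrite IH !ffunE; case: (c x); case: (f x) => //=; lia.
rewrite IH !ffunE -andbA; congr (_ && _); case: cs => [|c cs] /=; rewrite ?ffunE.
  by case: b => /=; lia.
by case: (c x); case: b => /=; lia.
Qed.

Section Dec.
Variable y : T.
Definition dec_delta (w : bool) (_ : bool) (c : col) : bool * col :=
  (w && ~~ c y, [ffun x => if x == y then c x (+) w else c x]).

Lemma dec_flag w cs : (transduce dec_delta (fun _ => None) w (pad c0 [::] cs)).1 =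
  w && (column_val cs y == 0).
Proof.
elim: cs w => [|c cs IH] w /=; first by rewrite andbT.
by rewrite IH; case: (c y); case: w => //=; lia.
Qed.

(** The state is the borrow. If none is left at the end, the subtraction was exact; the equation is
    additive to avoid truncated subtraction. *)
Lemma dec_val w cs x :
  let F := transduce dec_delta (fun _ => None) w (pad c0 [::] cs) in
  ~~ F.1 -> column_val F.2 x + (if x == y then w : nat else 0) = column_val cs x.
Proof.
elim: cs w => [|c cs IH] w /=; first by case: w; rewrite ?if_same.
move=> /IH /=; rewrite !ffunE; case: (x =P y) => [->|_]; last by lia.
by case: (c y); case: w => /=; lia.
Qed.

Lemma size_dec w cs :
  size (transduce dec_delta (fun _ => None) w (pad c0 [::] cs)).2 = size cs.
Proof. by elim: cs w => //= c cs IH w; rewrite IH. Qed.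
End Dec.

Definition cmp_delta (t : {ffun T * T -> bool}) (_ : bool) (c : col) :
    {ffun T * T -> bool} * col :=
  ([ffun p => if c p.1 == c p.2 then t p else c p.2], c).

(** Columns arrive least significant first, so each differing bit overrules the verdict so far.
    Starting from [true] yields the non-strict comparison. *)
Lemma cmp_table t cs p :
  (transduce cmp_delta (fun _ => None) t (pad c0 [::] cs)).1 p =
  (column_val cs p.1 < column_val cs p.2) ||
  (column_val cs p.1 == column_val cs p.2) && t p.
Proof.
elim: cs t => [|c cs IH] t //=; rewrite IH !ffunE.
by case: (c p.1); case: (c p.2); case: (t p) => /=; lia.
Qed.

Lemma size_transduce_pad (S : finType) (delta : S -> bool -> col -> S * col) (s : S) u cs :
  size (transduce delta (fun _ => None) s (pad c0 u cs)).2 <= size u + size cs.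
Proof.
apply: leq_trans (size_pad c0 u cs).
by elim: (pad c0 u cs) s => //= w ws IH s; rewrite ltnS.
Qed.
End Columns.

(** * The stack program *)

Lemma enc_nat_num_code (G : finType) (e : letter -> G) n :
  map e (enc_nat n) = num_code e (bin n n).
Proof. by rewrite /enc_nat /num_code -cats1. Qed.

Lemma size_enc_nat n : size (enc_nat n) = (size (bin n n)).+1.
Proof. by rewrite /enc_nat size_cat size_map addn1. Qed.

Section Main.
Variables (j : nat) (M1 M2 : TM).

(* Registers: the candidate names, the sums N(a,b) + e w, and the number of voters
   still to be read. *)
Definition reg : finType := ('I_j + ('I_j * 'I_j * bool + unit))%type.
Definition rname (i : 'I_j) : reg := inl i.
Definition rsum (a b : 'I_j) (e : bool) : reg := inr (inl (a, b, e)).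
Definition rcnt : reg := inr (inr tt).
Definition column : finType := {ffun reg -> bool}.
Definition c0 : column := [ffun => false].

Definition sym : finType := (letter + column + (tm_sym M1 + tm_sym M2))%type.
Definition eL (a : letter) : sym := inl (inl a).
Definition dL (g : sym) : option letter := if g is inl (inl a) then Some a else None.
Definition eC (c : column) : sym := inl (inr c).
Definition dC (g : sym) : option column := if g is inl (inr c) then Some c else None.
Definition e1 (a : tm_sym M1) : sym := inr (inl a).
Definition d1 (g : sym) : option (tm_sym M1) := if g is inr (inl a) then Some a else None.
Definition e2 (a : tm_sym M2) : sym := inr (inr a).
Definition d2 (g : sym) : option (tm_sym M2) := if g is inr (inr a) then Some a else None.

(* Input, unread letters, columns, scratch, log of the candidate names, discarded log,
   then for each tie-breaking machine its left tape, right tape and output, and finally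
   the weight of the current voter (it precedes the vote that decides where it is added). *)
Definition idx : finType := 'I_13.
Definition sIn : idx := @Ordinal 13 0 isT.
Definition sA : idx := @Ordinal 13 1 isT.
Definition sK : idx := @Ordinal 13 2 isT.
Definition sTm : idx := @Ordinal 13 3 isT.
Definition sLg : idx := @Ordinal 13 4 isT.
Definition sJk : idx := @Ordinal 13 5 isT.
Definition sL1 : idx := @Ordinal 13 6 isT.
Definition sR1 : idx := @Ordinal 13 7 isT.
Definition sO1 : idx := @Ordinal 13 8 isT.
Definition sL2 : idx := @Ordinal 13 9 isT.
Definition sR2 : idx := @Ordinal 13 10 isT.
Definition sO2 : idx := @Ordinal 13 11 isT.
Definition sWt : idx := @Ordinal 13 12 isT.

Local Notation store := (store idx sym).
Local Notation prog := (prog idx sym).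

Definition reading (S : finType) lg (delta : S -> bool -> column -> S * column) fin st :=
  pass c0 dL eC dC sA sK sTm lg delta fin st.
Definition read_add (mask : pred reg) lg : prog column :=
  reading lg (add_delta mask) Some c0.
Definition read_match lg : prog column :=
  reading lg (@match_delta reg) (fun _ => None) [ffun => true].

(* [w] is the unread input and [val] the register contents.  A pass consuming a number
   adds at most as many columns as letters read, whence the bound [B] on the sum. *)
Definition holds (tr : seq idx) (w : seq letter) (val : reg -> nat) (B : nat)
    (aux : store) (s : store) : Prop :=
  exists cs, [/\ s sA = map eL w, s sK = map eC cs, column_val cs =1 val,
    size cs + size w <= B & s sTm = [::] /\ {in tr, s =1 aux}].

(** [holds] prescribes, through [aux], the contents of the stacks in [tr] only; the others may hold
    leftovers. The three working stacks are described separately and must stay out of [tr]. *)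
Definition untouched (tr : seq idx) := [&& sA \notin tr, sK \notin tr & sTm \notin tr].

Lemma holdsW tr tr' w val B B' aux s : {subset tr' <= tr} -> B <= B' ->
  holds tr w val B aux s -> holds tr' w val B' aux s.
Proof.
move=> st hB [cs [h1 h2 h3 h4 [h5 h6]]]; exists cs; split=> //; first exact: leq_trans hB.
by split=> // k /st; apply: h6.
Qed.

Lemma uniqAKTL lg : untouched [:: lg] -> uniq [:: sA; sK; sTm; lg].
Proof.
by rewrite /untouched /= !inE => /and3P[h1 h2 h3]; rewrite !negb_or h1 h2 h3.
Qed.

Section Reading.
Variables (X : Type) (sz : X -> nat) (dm : X -> Prop) (n : X -> nat) (w : X -> seq letter).
Variables (val val' : X -> reg -> nat) (B : X -> nat) (aux : X -> store) (tr : seq idx).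
Hypothesis polyB : exists c k, forall x, dm x -> B x <= c * (sz x).+1 ^ k.
Variables (S : finType) (delta : S -> bool -> column -> S * column).
Variables (fin : S -> option column) (st : S) (res : X -> S -> Prop) (lg : idx) (sl : nat).
Hypotheses (hlg : untouched [:: lg]) (htr : untouched tr).

(** [sl] bounds the columns that [fin] may append. For [sl = 1] the new column takes the place of
    the separator in the budget [B]. For [sl = 0] one unit is released, namely the one spent when a
    separator has been pushed beforehand. *)
Lemma readingP :
  (forall x cs, dm x -> column_val cs =1 val x ->
     let F := transduce delta fin st (pad c0 (bin (n x) (n x)) cs) in
     [/\ column_val F.2 =1 val' x, size F.2 <= size (bin (n x) (n x)) + size cs + sl &
      res x F.1]) ->
  triple sz (fun x s => dm x /\ holds tr (enc_nat (n x) ++ w x) (val x) (B x + (1 - sl)) (aux x) s)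
    (reading lg delta fin st)
    (fun x r s => (dm x /\ res x r) /\ holds tr (w x) (val' x) (B x + (sl - 1))
       (upd (aux x) lg (catrev (num_code eL (bin (n x) (n x))) (aux x lg))) s).
Proof.
move=> H; have [c [k hB]] := polyB.
apply: (tripleA (c0 := c + 1) (k0 := k) (@passP _ _ _ _ c0 eL dL eC dC
  (fun=> erefl) (fun=> erefl) _ _ _ _ (uniqAKTL hlg) delta fin st)).
move=> x s [dx [cs [EA EK Ec hs [ET Etr]]]].
exists (s, bin (n x) (n x), map eL (w x), cs); split=> //.
- by rewrite EA map_cat enc_nat_num_code.
- suff : size (bin (n x) (n x)) + size cs <= (c + 1) * (sz x).+1 ^ k by [].
  move: hs (hB x dx); rewrite size_cat size_enc_nat mulnDl mul1n.
  have : 0 < (sz x).+1 ^ k by rewrite expn_gt0.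
  by clear; lia.
move=> r s' [-> ->]; have [h1 h2 h3] := H x cs dx Ec; split=> //.
move: (hlg) (htr); rewrite /untouched !inE => /and3P[la lk lt] /and3P[ta tk tt].
exists (transduce delta fin st (pad c0 (bin (n x) (n x)) cs)).2; split=> //.
- by rewrite (upd_ne _ _ la) (upd_ne _ _ (isT : sA != sK)) upd_eq.
- by rewrite (upd_ne _ _ lk) upd_eq.
- apply: leq_trans (_ : size (bin (n x) (n x)) + size cs + sl + size (w x) <= _).
    by rewrite leq_add2r.
  by move: hs; rewrite size_cat size_enc_nat; clear; lia.
split; first by rewrite (upd_ne _ _ lt) !upd_ne.
move=> i it; rewrite /upd; case: (i =P lg) => [e|_].
  by rewrite -e Etr.
case: (i =P sK) => [e|_]; first by rewrite -e it in tk.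
by case: (i =P sA) => [e|_]; [rewrite -e it in ta|apply: Etr].
Qed.
End Reading.

Lemma holds_upd tr w val B aux lg u s : lg \notin tr ->
  holds tr w val B (upd aux lg u) s <-> holds tr w val B aux s.
Proof.
move=> hl; split=> -[cs [h1 h2 h3 h4 [h5 h6]]]; exists cs; do !split=> //;
  move=> k hk; rewrite h6 // upd_ne //; by apply: contraNneq hl => <-.
Qed.

Lemma holds_val tr w val val' B aux s : val =1 val' ->
  holds tr w val B aux s -> holds tr w val' B aux s.
Proof.
by move=> e [cs [h1 h2 h3 h4 [h5 h6]]]; exists cs; do !split=> //; move=> t; rewrite h3 e.
Qed.

Lemma holds_aux tr w val B aux aux' s : {in tr, aux =1 aux'} ->
  holds tr w val B aux s -> holds tr w val B aux' s.
Proof.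
by move=> e [cs [h1 h2 h3 h4 [h5 h6]]]; exists cs; do !split=> //; move=> k hk; rewrite h6 // e.
Qed.

(** A lone separator is the code of 0. Pushing it allows a pass over the columns that consumes no
    genuine input. *)
Definition zero_test : prog column :=
  Bind (Push sA (eL lsep)) (fun _ => read_match sJk).
Definition decrement : prog bool :=
  Bind (Push sA (eL lsep)) (fun _ => reading sJk (dec_delta rcnt) (fun _ => None) true).
Definition compare : prog {ffun reg * reg -> bool} :=
  Bind (Push sA (eL lsep)) (fun _ =>
    reading sJk (@cmp_delta reg) (fun _ => None) [ffun => true]).

Section Ops.
Variables (X : Type) (sz : X -> nat) (dm : X -> Prop) (w : X -> seq letter).
Variables (val : X -> reg -> nat) (B : X -> nat) (aux : X -> store) (tr : seq idx).
Hypothesis polyB : exists c k, forall x, dm x -> B x <= c * (sz x).+1 ^ k.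
Hypothesis (htr : untouched tr).

Lemma addP n mask lg : untouched [:: lg] ->
  triple sz (fun x s => dm x /\ holds tr (enc_nat (n x) ++ w x) (val x) (B x) (aux x) s)
    (read_add mask lg)
    (fun x _ s => dm x /\ holds tr (w x) (fun t => val x t + (if mask t then n x else 0)) (B x)
       (upd (aux x) lg (catrev (num_code eL (bin (n x) (n x))) (aux x lg))) s).
Proof.
move=> hlg; have H := @readingP X sz dm n w val
  (fun x t => val x t + (if mask t then n x else 0)) B aux tr polyB _ (add_delta mask)
  Some c0 (fun _ _ => True) lg 1 hlg htr.
apply: tripleC (H _) _ _ => {H}.
- move=> x cs dx Ec F; split=> //.
    by move=> t; rewrite /F add_val Ec bits_val_bin // ffunE addn0.
  by apply: leq_trans (size_transduce _ _ _ _) _; rewrite addn1 ltnS; apply: size_pad.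
- by move=> x s; rewrite subnn addn0.
- by move=> x r s; rewrite subnn addn0 => -[[]].
Qed.

Hypothesis trJ : sJk \notin tr.

Lemma matchP1 n lg : untouched [:: lg] ->
  triple sz (fun x s => dm x /\ holds tr (enc_nat (n x) ++ w x) (val x) (B x).+1 (aux x) s)
    (read_match lg)
    (fun x r s => (dm x /\ r = [ffun t => val x t == n x]) /\ holds tr (w x) (val x) (B x)
       (upd (aux x) lg (catrev (num_code eL (bin (n x) (n x))) (aux x lg))) s).
Proof.
move=> hlg; have H := @readingP X sz dm n w val val B aux tr polyB _ (@match_delta reg)
  (fun _ => None) [ffun => true] (fun x r => r = [ffun t => val x t == n x]) lg 0 hlg htr.
apply: tripleC (H _) _ _ => {H}.
- move=> x cs dx Ec F; split.
  + by move=> t; rewrite /F match_val Ec.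
  + by rewrite addn0; apply: size_transduce_pad.
  + by apply/ffunP => t; rewrite /F match_flag !ffunE Ec bits_val_bin.
- by move=> x s; rewrite addn1.
- by move=> x r s; rewrite addn0.
Qed.

Lemma matchP n lg : untouched [:: lg] ->
  triple sz (fun x s => dm x /\ holds tr (enc_nat (n x) ++ w x) (val x) (B x) (aux x) s)
    (read_match lg)
    (fun x r s => (dm x /\ r = [ffun t => val x t == n x]) /\ holds tr (w x) (val x) (B x)
       (upd (aux x) lg (catrev (num_code eL (bin (n x) (n x))) (aux x lg))) s).
Proof.
move=> hlg; apply: tripleC (matchP1 n hlg) _ _ => // x s [dx h]; split=> //.
by apply: holdsW h.
Qed.

Lemma push_sepP :
  triple sz (fun x s => dm x /\ holds tr (w x) (val x) (B x) (aux x) s)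
    (Push sA (eL lsep))
    (fun x _ s => dm x /\ holds tr (enc_nat 0 ++ w x) (val x) (B x).+1 (aux x) s).
Proof.
apply: triplePush => x s [dx [cs [h1 h2 h3 h4 [h5 h6]]]]; split=> //.
move: htr => /and3P[tA _ _].
exists cs; do !split=> //; first by rewrite upd_eq h1.
  by rewrite /= addnS ltnS.
by move=> k hk; rewrite upd_ne ?h6 //; apply: contraNneq tA => <-.
Qed.

Lemma zero_testP :
  triple sz (fun x s => dm x /\ holds tr (w x) (val x) (B x) (aux x) s) zero_test
    (fun x r s => (dm x /\ r = [ffun t => val x t == 0]) /\
       holds tr (w x) (val x) (B x) (aux x) s).
Proof.
apply: tripleBind push_sepP _ => _.
apply: tripleC (matchP1 (fun=> 0) (isT : untouched [:: sJk])) _ _ => // x r s [h1 h2].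
by split=> //; move: h2; rewrite holds_upd.
Qed.

Lemma decrementP : (forall x, dm x -> 0 < val x rcnt) ->
  triple sz (fun x s => dm x /\ holds tr (w x) (val x) (B x) (aux x) s) decrement
    (fun x _ s => dm x /\
       holds tr (w x) (fun t => val x t - (t == rcnt)) (B x) (aux x) s).
Proof.
move=> pos; apply: tripleBind push_sepP _ => _.
have H := @readingP X sz dm (fun=> 0) w val (fun x t => val x t - (t == rcnt)) B aux tr
  polyB _ (dec_delta rcnt) (fun _ => None) true (fun _ _ => True) sJk 0 isT htr.
apply: tripleC (H _) _ _ => {H}.
- move=> x cs dx Ec F; split=> //; last by rewrite /F size_dec addn0.
  have hF : ~~ F.1 by rewrite /F dec_flag Ec -lt0n pos.
  by move=> t; have := dec_val t hF; rewrite -/F Ec; case: (t == rcnt) => <-; rewrite ?addnK ?addn0 ?subn0.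
- by move=> x s; rewrite addn1.
- by move=> x r s [[dx _]]; rewrite addn0 holds_upd.
Qed.

Lemma compareP :
  triple sz (fun x s => dm x /\ holds tr (w x) (val x) (B x) (aux x) s) compare
    (fun x r s => dm x /\ r = [ffun p => val x p.1 <= val x p.2]).
Proof.
apply: tripleBind push_sepP _ => _.
have H := @readingP X sz dm (fun=> 0) w val val B aux tr polyB _ (@cmp_delta reg)
  (fun _ => None) [ffun => true] (fun x r => r = [ffun p => val x p.1 <= val x p.2]) sJk 0 isT htr.
apply: tripleC (H _) _ _ => {H}.
- move=> x cs dx Ec F; split.
  + have E (cs1 : seq column) t : (transduce (@cmp_delta reg) (fun _ => None) t (pad c0 [::] cs1)).2 = cs1.
      by elim: cs1 t => [|c cs1 IH] t //; congr (_ :: _); apply: IH.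
    by rewrite /F E.
  + by rewrite addn0; apply: size_transduce_pad.
  + by apply/ffunP => p; rewrite /F cmp_table !ffunE !Ec andbT orbC -leq_eqVlt.
- by move=> x s; rewrite addn1.
- by move=> x r s [].
Qed.

End Ops.

(** * Names read as positions *)

Definition conv (f : column) : nat := if [pick i | f (rname i)] is Some i then i : nat else j.

(** Flags of sum registers may be set by coincidence and are ignored; among the name registers
    exactly one matches, since names are distinct. *)
Lemma conv_index (C : seq nat) c (v : reg -> nat) : uniq C -> size C = j -> c \in C ->
  (forall i, v (rname i) = nth 0 C i) -> conv [ffun t => v t == c] = index c C.
Proof.
move=> uC sC cC hv; rewrite /conv; case: pickP => [i|H].
  by rewrite ffunE hv => /eqP <-; rewrite index_uniq ?sC.
have hi : index c C < j by rewrite -sC index_mem.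
by have := H (Ordinal hi); rewrite ffunE hv /= nth_index ?eqxx.
Qed.

(** [acc] is a parameter of the program text and not data on a stack: unrolling [n] readings, each
    with finitely many results, keeps the list of positions in the control state. *)
Fixpoint idents (R : finType) n acc (k : seq nat -> prog R) : prog R :=
  if n is n'.+1 then
    Bind (read_match sJk) (fun f => idents n' (rcons acc (conv f)) k)
  else k acc.

Lemma identsP (R : finType) (X : Type) (sz : X -> nat) (w : X -> seq letter)
    (val : X -> reg -> nat) (B : X -> nat) (aux : X -> store) (tr : seq idx) (C : X -> seq nat) k
    (Q : X -> R -> store -> Prop) : untouched tr -> sJk \notin tr ->
  forall n (dm : X -> Prop) (l : X -> seq nat) acc,
  (exists c k, forall x, dm x -> B x <= c * (sz x).+1 ^ k) ->
  (forall x, dm x -> [/\ uniq (C x), size (C x) = j, size (l x) = n,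
     {subset l x <= C x} & forall i, val x (rname i) = nth 0 (C x) i]) ->
  (forall ids, triple sz (fun x s => (dm x /\ ids = acc ++ [seq index c (C x) | c <- l x]) /\
      holds tr (w x) (val x) (B x) (aux x) s) (k ids) Q) ->
  triple sz (fun x s => dm x /\ holds tr (enc_nats (l x) ++ w x) (val x) (B x) (aux x) s)
    (idents n acc k) Q.
Proof.
move=> htr trJ; elim=> [|n IH] dm l acc pB H Hk /=.
  apply: tripleC (Hk acc) _ _ => // x s [dx]; have [_ _ /size0nil -> _ _] := H x dx.
  by rewrite cats0.
apply: (tripleBind (M := fun x r s => (dm x /\ r = [ffun t => val x t == head 0 (l x)]) /\
   holds tr (enc_nats (behead (l x)) ++ w x) (val x) (B x) (aux x) s)).
  apply: tripleC (matchP (fun x => enc_nats (behead (l x)) ++ w x) val aux pB htr (fun x => head 0 (l x))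
     (isT : untouched [:: sJk])) _ _.
    move=> x s [dx h]; split=> //; have [_ _ sl _ _] := H x dx.
    by case: (l x) sl h => // a l' _; rewrite /enc_nats /= -catA.
  by move=> x r s [h1 h2]; split=> //; move: h2; rewrite holds_upd.
move=> f; apply: IH.
- by case: pB => c [k0 hB]; exists c, k0 => x [/hB].
- move=> x [dx _]; have [h1 h2 h3 h4 h5] := H x dx; split=> //.
    by rewrite size_behead h3.
  by move=> z /mem_behead; apply: h4.
move=> ids; apply: tripleC (Hk ids) _ _ => // x s [[[dx ef] ei] h]; split=> //; split=> //.
have [h1 h2 h3 h4 h5] := H x dx; move: ei ef.
case: (l x) h3 h4 => // a l' _ h4 -> ->; rewrite /= (conv_index h1 h2 _ h5) ?cat_rcons //.
by apply: h4; rewrite mem_head.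
Qed.

Section Transfers.
Variables (X : Type) (sz : X -> nat) (dm : X -> Prop) (w u : X -> seq letter).
Variables (val : X -> reg -> nat) (B : X -> nat) (aux : X -> store) (tr : seq idx).
Hypothesis polyB : exists c k, forall x, dm x -> B x <= c * (sz x).+1 ^ k.
Hypothesis (htr : untouched tr).

(** Machine outputs and the postponed weight lie reversed on their stacks. Poured onto the unread
    input they are read by the ordinary passes, at the price of their length in the budget. *)
Lemma undrainP src : src != sA -> src \in tr ->
  (exists c k, forall x, dm x -> size (u x) <= c * (sz x).+1 ^ k) ->
  triple sz (fun x s => (dm x /\ aux x src = rev (map eL (u x))) /\
       holds tr (w x) (val x) (B x) (aux x) s)
    (drain sym src sA)
    (fun x _ s => dm x /\ holds tr (u x ++ w x) (val x) (B x + size (u x)) (upd (aux x) src [::]) s).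
Proof.
move=> sA' st [c [k hc]]; apply: (tripleA (c0 := c) (k0 := k) (drainP sym sA')).
move=> x s [[dx ea] [cs [h1 h2 h3 h4 [h5 h6]]]]; exists s; split=> //.
  by rewrite h6 // ea size_rev size_map; apply: hc.
move=> _ s' ->; split=> //; move: htr => /and3P[tA tK tT].
have ne k0 : k0 \notin tr -> k0 != src by apply: contraNneq => ->.
exists cs; split=> //.
- by rewrite upd_eq h1 h6 // ea catrevE revK map_cat.
- by rewrite upd_ne // upd_ne // ne.
- by rewrite size_cat addnCA addnC leq_add2r.
split; first by rewrite upd_ne // upd_ne // ne.
move=> k0 hk; rewrite upd_ne; last by apply: contraNneq tA => <-.
by rewrite /upd; case: eqP => // _; apply: h6.
Qed.

Definition grab (dst : idx) : prog unit :=
  Iter (fun _ : unit => Bind (Pop sym sA) (fun o => if o is Some g then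
      Bind (Push dst g) (fun _ =>
        Ret idx sym (if dL g == Some lsep then inr tt else inl tt : unit + unit)%type)
    else Ret idx sym (inr tt : unit + unit)%type)) tt.

Lemma grabP n dst : dst \in tr ->
  (exists c k, forall x, dm x -> size (enc_nat (n x)) <= c * (sz x).+1 ^ k) ->
  triple sz (fun x s => dm x /\
       holds tr (enc_nat (n x) ++ w x) (val x) (B x + size (enc_nat (n x))) (aux x) s)
    (grab dst)
    (fun x _ s => dm x /\ holds tr (w x) (val x) (B x)
       (upd (aux x) dst (catrev (map eL (enc_nat (n x))) (aux x dst))) s).
Proof.
move=> dt [c [k hc]]; move: htr => /and3P[tA tK tT].
have ne k0 : k0 \notin tr -> k0 != dst by apply: contraNneq => ->.
apply: (@tripleIter _ _ _ _ _ _ _ _ _ _ (fun x m (_ : unit) s => dm x /\ exists v lg cs,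
   [/\ m = (size v).+1, s sA = map eL (map bit_letter v ++ lsep :: w x), s sK = map eC cs,
     [/\ column_val cs =1 val x, size cs + size (w x) <= B x & s sTm = [::]] &
     [/\ {in tr, s =1 upd (aux x) dst lg} &
     catrev (map eL (map bit_letter v ++ [:: lsep])) lg =
     catrev (map eL (enc_nat (n x))) (aux x dst)]]) c k).
  move=> x s [dx [cs [h1 h2 h3 h4 [h5 h6]]]]; exists (size (enc_nat (n x))); first exact: hc.
  split=> //; exists (bin (n x) (n x)), (aux x dst), cs; split=> //.
  - exact: size_enc_nat.
  - by rewrite h1 -cat_rcons -cats1.
  - split=> //; move: h4; rewrite size_cat; clear; lia.
  - by rewrite upd_id.
case; apply: tripleE => -[x m] s /= [dx [v [lg [cs [-> h1 h2 [h3 h4 h5] [h6 h7]]]]]].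
have dA : dst != sA by apply: contraNneq tA => <-.
have tr' (y : seq sym) a : {in tr, upd (upd s sA y) dst (a :: upd s sA y dst) =1
    upd (aux x) dst (a :: lg)}.
  move=> i hi; rewrite /upd; case: (i =P dst) => [_|ni].
    by rewrite (negbTE dA) (h6 dst) // upd_eq.
  by case: (i =P sA) => [e|_]; [rewrite -e hi in tA|rewrite h6 // upd_ne //; apply/eqP].
have kA (y : seq sym) z : upd (upd s sA y) dst z sA = y by rewrite upd_ne ?upd_eq ?ne.
have kK (y : seq sym) z i : i \notin tr -> i != sA -> upd (upd s sA y) dst z i = s i.
  by move=> hi iA; rewrite !upd_ne ?ne.
rewrite h1; case: v h1 h7 => [|b v] /= h1 h7.
  split=> //; exists cs; split; rewrite ?kA ?kK //; split; rewrite ?kK // => i hi.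
  by rewrite tr' // -h7.
have -> : (Some (bit_letter b) == Some lsep) = false by case: (b).
exists (size v).+1 => //; split=> //; exists v, (eL (bit_letter b) :: lg), cs.
by split; rewrite ?kA ?kK //; split=> //; rewrite kK.
Qed.

End Transfers.

(** * Voters, names and manipulators *)

Definition wsum (C : seq nat) (V : seq (nat * seq nat)) (a b : nat) : nat :=
  \sum_(v <- V) (if prefers v.2 (nth 0 C a) (nth 0 C b) then v.1 else 0).

(** The register contents as a function of the progress made: voters [V] read, manipulator weight
    [m] added, [cnt] voters left. *)
Definition vals (C : seq nat) V (m cnt : nat) (t : reg) : nat :=
  match t with
  | inl i => nth 0 C i
  | inr (inl (a, b, e)) => wsum C V a b + (if e then m else 0)
  | inr (inr _) => cnt
  end.

Definition vote_mask (ids : seq nat) (t : reg) : bool :=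
  if t is inr (inl (a, b, _)) then prefers ids a b else false.

Lemma index_index (C v : seq nat) (a : 'I_j) : uniq C -> size C = j -> perm_eq v C ->
  index (a : nat) [seq index c C | c <- v] = index (nth 0 C a) v.
Proof.
move=> uC sC /perm_mem vC.
have : {subset v <= C} by move=> c; rewrite vC.
elim: v {vC} => //= c v IH sub; rewrite IH; last by move=> d dv; apply: sub; rewrite inE dv orbT.
congr (if _ then _ else _); apply/eqP/eqP => [<-|->]; last by rewrite index_uniq ?sC.
by rewrite nth_index // sub ?mem_head.
Qed.

Lemma vals_vote C V v m cnt t : uniq C -> size C = j -> perm_eq v.2 C ->
  vals C (rcons V v) m cnt t =
  vals C V m cnt t + (if vote_mask [seq index c C | c <- v.2] t then v.1 else 0).
Proof.
move=> uC sC vC; case: t => [i|[[[a b] e]|[]]] /=; rewrite ?addn0 //.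
by rewrite /wsum -cats1 big_cat big_seq1 /= /prefers !index_index // addnAC.
Qed.

Definition enc_voters (V : seq (nat * seq nat)) := enc_nats (flatten [seq x.1 :: x.2 | x <- V]).

Lemma enc_voters_cons v V : enc_voters (v :: V) = enc_nat v.1 ++ enc_nats v.2 ++ enc_voters V.
Proof. by rewrite /enc_voters /= /enc_nats /= map_cat flatten_cat. Qed.

Lemma size_voters V : size V <= size (enc_voters V).
Proof.
elim: V => // v V IH; rewrite enc_voters_cons size_cat size_enc_nat addSn ltnS size_cat.
by apply: leq_trans IH _; rewrite addnA leq_addl.
Qed.

Definition voter_body (_ : unit) : prog (unit + unit)%type :=
  Bind zero_test (fun z => if z rcnt then Ret idx sym (inr tt : unit + unit)%type else
  Bind decrement (fun _ =>
  Bind (grab sWt) (fun _ =>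
  idents j [::] (fun ids =>
  Bind (drain sym sWt sA) (fun _ =>
  Bind (read_add (vote_mask ids) sJk) (fun _ => Ret idx sym (inl tt : unit + unit)%type)))))).

Lemma votersP (X : Type) (sz : X -> nat) (dm : X -> Prop) (C : X -> seq nat)
    (V : X -> seq (nat * seq nat)) (w : X -> seq letter) (B : X -> nat) (aux : X -> store) tr :
  (exists c k, forall x, dm x -> B x <= c * (sz x).+1 ^ k) -> untouched tr -> sJk \notin tr ->
  sWt \in tr ->
  (forall x, dm x -> [/\ uniq (C x), size (C x) = j, all (fun v => perm_eq v.2 (C x)) (V x) &
     aux x sWt = [::]]) ->
  triple sz (fun x s => dm x /\
       holds tr (enc_voters (V x) ++ w x) (vals (C x) [::] 0 (size (V x))) (B x) (aux x) s)
    (Iter voter_body tt)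
    (fun x _ s => dm x /\ holds tr (w x) (vals (C x) (V x) 0 0) (B x) (aux x) s).
Proof.
move=> [c [k hB]] htr trJ trW H.
apply: (@tripleIter _ _ _ _ _ _ _ _ _ _ (fun x m (_ : unit) s => dm x /\ exists D E,
  [/\ V x = D ++ E, m = size E &
   holds tr (enc_voters E ++ w x) (vals (C x) D 0 (size E)) (B x) (aux x) s]) c k).
  move=> x s [dx h]; exists (size (V x)).
    apply: leq_trans (hB x dx); case: h => cs [_ _ _ h _]; apply: leq_trans h.
    by rewrite size_cat addnCA; apply: leq_trans (size_voters _) _; apply: leq_addr.
  by split=> //; exists [::], (V x).
case.
(* The ghost of the body also records the split into voters read and voters to come, while its size
   remains that of the instance, as [tripleIter] requires. *)
pose Y := (X * (seq (nat * seq nat) * seq (nat * seq nat)))%type.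
pose szY (y : Y) := sz y.1.
pose dmY (y : Y) := dm y.1 /\ V y.1 = y.2.1 ++ y.2.2.
pose hd (y : Y) := head (0, [::]) y.2.2.
pose wY (y : Y) := enc_voters y.2.2 ++ w y.1.
pose wT (y : Y) := enc_voters (behead y.2.2) ++ w y.1.
pose vY (y : Y) := vals (C y.1) y.2.1 0 (size y.2.2).
pose vY' (y : Y) := vals (C y.1) y.2.1 0 (size y.2.2).-1.
pose BY (y : Y) := B y.1.
pose aY (y : Y) := aux y.1.
have pBY (dm' : Y -> Prop) : (forall y, dm' y -> dmY y) ->
    exists c k, forall y, dm' y -> BY y <= c * (szY y).+1 ^ k.
  by move=> sub; exists c, k => y /sub [dy _]; apply: hB.
apply: (tripleA (szY := szY) (c0 := 1) (k0 := 1) (P' := fun y s => dmY y /\ holds tr (wY y) (vY y) (BY y) (aY y) s)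
  (Q' := fun y r s => match r with
    | inl _ => dmY y /\ exists2 v, y.2.2 = v :: behead y.2.2 &
        holds tr (wT y) (vals (C y.1) (rcons y.2.1 v) 0 (size y.2.2).-1) (BY y) (aY y) s
    | inr _ => [/\ dmY y, y.2.2 = [::] & holds tr (wY y) (vY y) (BY y) (aY y) s] end)); last first.
  move=> [x m] s [/= dx [D [E [VE -> h]]]]; exists (x, (D, E)); split=> //.
    by rewrite mul1n expn1.
  move=> [_|_] s' /=; last first.
    by move=> [_ e]; rewrite /wY /vY /= e; move: VE; rewrite e cats0 => ->; split.
  move=> [_ [v Ev h']]; exists (size (behead E)); first by rewrite Ev /=.
  by split=> //; exists (rcons D v), (behead E); rewrite cat_rcons -Ev; split=> //; rewrite size_behead.
rewrite /voter_body; apply: (tripleBind (M := fun y (z : column) s => (dmY y /\ z rcnt = (size y.2.2 == 0)) /\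
    holds tr (wY y) (vY y) (BY y) (aY y) s)).
  apply: tripleC (zero_testP wY vY aY (pBY dmY (fun _ => id)) htr trJ) _ _ => // y r s [[dy ->] h].
  by rewrite ffunE.
move=> z; case: ifP => hz.
  apply: tripleRet => y s [[dy /esym/eqP/size0nil e] h]; split=> //.
pose dm1 (y : Y) := dmY y /\ size y.2.2 != 0.
apply: (tripleBind (M := fun y (_ : bool) s => dm1 y /\ holds tr (wY y) (vY' y) (BY y) (aY y) s)).
  apply: tripleC (decrementP wY (dm := dm1) (val := vY) aY (pBY dm1 (fun _ => @proj1 _ _)) htr trJ _) _ _.
  - by move=> y [_]; rewrite lt0n.
  - by move=> y s [[dy e] h]; split=> //; split; rewrite -?e.
  - move=> y r s [dy h]; split=> //; apply: holds_val h => t; rewrite /vY /vY'.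
    by case: t => [i|[[[a b] e]|[]]]; rewrite /= ?subn0 ?subn1.
move=> _; pose e y := size (enc_nat (hd y).1).
(* While the weight is parked on [sWt] its length is taken out of the budget, and [B3] restores it.
   The inequality makes the subtraction in [B2] exact. *)
pose dm2 (y : Y) := dm1 y /\ e y <= BY y.
pose B2 y := BY y - e y.
pose a2 y := upd (aY y) sWt (catrev (map eL (enc_nat (hd y).1)) [::]).
have pe : exists c k, forall y, dm2 y -> e y <= c * (szY y).+1 ^ k.
  by exists c, k => y [[[dy _] _] h]; apply: leq_trans h _; apply: hB.
have pB2 : exists c k, forall y, dm2 y -> B2 y <= c * (szY y).+1 ^ k.
  exists c, k => y [[[dy _] _] h]; apply: leq_trans (leq_subr _ _) _; exact: hB.
pose w2 y := enc_nats (hd y).2 ++ wT y.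
apply: (tripleBind (M := fun y (_ : unit) s => dm2 y /\ holds tr (w2 y) (vY' y) (B2 y) (a2 y) s)).
  apply: tripleC (grabP (dm := dm2) w2 vY' B2 aY htr trW pe) _ _.
  - move=> y s [[dy ne] h]; split; first split=> //.
      case: h => cs [_ _ _ h _]; apply: leq_trans h; apply: leq_trans (leq_addl _ _).
      rewrite /wY /e /hd; case: y.2.2 ne => // v V' _.
      by rewrite enc_voters_cons -catA [X in _ <= X]size_cat leq_addr.
    apply: (holdsW (tr := tr) (B := BY y)) => //; last first.
      move: h; rewrite /wY /w2 /wT /hd; case: y.2.2 ne => // v V' _.
      by rewrite enc_voters_cons -!catA; apply.
    by rewrite /B2 -/(e y) addnC -leq_subLR.
  - move=> y r s [dy h]; split=> //; apply: holds_aux h => i _; rewrite /a2 /aY.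
    by case: dy => -[[dy _] _] _; have [_ _ _ ->] := H _ dy.
move=> _.
apply: (@identsP _ Y szY wT vY' B2 a2 tr (fun y => C y.1) _ _ htr trJ j dm2 (fun y => (hd y).2) [::] pB2).
  move=> y [[[dy Ey] ne] _]; have [h1 h2 h3 h4] := H _ dy; split=> //.
  - move: h3; rewrite Ey all_cat /hd; case: y.2.2 ne => // v V' _ /and3P[_ /perm_size -> _].
    exact: h2.
  - move: h3; rewrite Ey all_cat /hd; case: y.2.2 ne => // v V' _ /and3P[_ /perm_mem h _].
    by move=> i; rewrite h.
move=> ids; pose dm3 (y : Y) := dm2 y /\ ids = [seq index c (C y.1) | c <- (hd y).2].
pose B3 (y : Y) := B2 y + e y.
have pB3 : exists c k, forall y, dm3 y -> B3 y <= c * (szY y).+1 ^ k.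
  by exists c, k => y [[[[dy _] _] h] _]; rewrite /B3 /B2 subnK //; apply: hB.
have pe' : exists c k, forall y, dm3 y -> e y <= c * (szY y).+1 ^ k.
  by case: pe => c' [k' h]; exists c', k' => y [/h].
apply: (tripleBind (M := fun y (_ : unit) s => dm3 y /\
   holds tr (enc_nat (hd y).1 ++ wT y) (vY' y) (B3 y) (aY y) s)).
  apply: tripleC (undrainP wT (u := fun y => enc_nat (hd y).1) vY' B2 a2 htr (isT : sWt != sA) trW pe') _ _.
    by move=> y s [[dy hi] h]; split=> //; split=> //; rewrite /a2 upd_eq catrevE cats0.
  move=> y r s [dy h]; split=> //; apply: holds_aux h => i _; rewrite /a2 /aY /upd.
  by case: dy => -[[[dy _] _] _] _; case: eqP => // ->; have [_ _ _ ->] := H _ dy.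
move=> _.
apply: (tripleBind (M := fun y (_ : column) s => dm3 y /\
   holds tr (wT y) (fun t => vY' y t + (if vote_mask ids t then (hd y).1 else 0)) (B3 y) (aY y) s)).
  apply: tripleC (addP wT vY' aY pB3 htr (fun y => (hd y).1) (vote_mask ids) (isT : untouched [:: sJk])) _ _ => //.
  by move=> y r s [dy h]; split=> //; move: h; rewrite holds_upd.
move=> _; apply: tripleRet => y s [[[[dy ne] he] hi] h]; split=> //.
exists (hd y); first by rewrite /hd; case: y.2.2 ne.
apply: (holdsW (tr := tr) (B := B3 y)) => //; last first.
  apply: holds_val h => t; case: dy => dy Ey; have [h1 h2 h3 h4] := H _ dy.
  rewrite hi /vY' vals_vote //.
  by move: h3; rewrite Ey all_cat /hd; case: y.2.2 ne => // v V' _ /and3P[_ -> _].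
by rewrite /B3 /B2 subnK.
Qed.

(** A name is stored by adding it to a register; in [main] all registers are 0 at that point. The
    log keeps the code of the whole list, which both tie-breaking machines take as input. *)
Fixpoint names (R : finType) (l : seq 'I_j) (p : prog R) : prog R :=
  if l is i :: l' then Bind (read_add (pred1 (rname i)) sLg) (fun _ => names l' p) else p.

Lemma namesP (R : finType) (X : Type) (sz : X -> nat) (dm : X -> Prop) (nm : X -> 'I_j -> nat)
    (w : X -> seq letter) (B : X -> nat) tr (p : prog R) (Q : X -> R -> store -> Prop) :
  (exists c k, forall x, dm x -> B x <= c * (sz x).+1 ^ k) -> untouched tr ->
  forall (l : seq 'I_j) (val : X -> reg -> nat) (aux : X -> store),
  triple sz (fun x s => dm x /\ holds tr (w x)
        (fun t => val x t + \sum_(i <- l) (if t == rname i then nm x i else 0)) (B x)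
        (upd (aux x) sLg (catrev (map eL (enc_nats (map (nm x) l))) (aux x sLg))) s) p Q ->
  triple sz (fun x s => dm x /\
      holds tr (enc_nats (map (nm x) l) ++ w x) (val x) (B x) (aux x) s) (names l p) Q.
Proof.
move=> pB htr; elim=> [|i l IH] val aux Hp /=.
  apply: tripleC Hp _ _ => // x s [dx h]; split=> //.
  by rewrite upd_id //; apply: holds_val h => t; rewrite big_nil addn0.
pose val1 x t := val x t + (if t == rname i then nm x i else 0).
pose aux1 x := upd (aux x) sLg (catrev (num_code eL (bin (nm x i) (nm x i))) (aux x sLg)).
apply: (tripleBind (M := fun x (_ : column) s => dm x /\
    holds tr (enc_nats (map (nm x) l) ++ w x) (val1 x) (B x) (aux1 x) s)) => [|_].
  apply: tripleC (addP (fun x => enc_nats (map (nm x) l) ++ w x) val aux pB htr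
    (fun x => nm x i) (pred1 (rname i)) (isT : untouched [:: sLg])) _ _ => //.
  by move=> x s; rewrite /enc_nats /= -catA.
apply: IH; apply: tripleC Hp _ _ => // x s [dx h]; split=> //.
apply: holds_aux (holds_val _ h) => [k _|t]; last by rewrite big_cons addnA.
rewrite /aux1 /upd eqxx; case: eqP => // _.
by rewrite -enc_nat_num_code /enc_nats /= map_cat catrev_catl.
Qed.

Definition peek : prog bool :=
  Bind (Pop sym sA) (fun o => if o is Some g then
    Bind (Push sA g) (fun _ => Ret idx sym true) else Ret idx sym false).

Definition manip_mask (t : reg) : bool := if t is inr (inl (_, _, e)) then e else false.

(** The manipulators' weights end the input, so the loop stops at the empty stack instead of
    counting. A unanimous coalition matters only through its total weight. *)
Definition manip_body (_ : unit) : prog (unit + unit)%type :=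
  Bind peek (fun b => if b then
    Bind (read_add manip_mask sJk) (fun _ => Ret idx sym (inl tt : unit + unit)%type)
  else Ret idx sym (inr tt : unit + unit)%type).

Lemma vals_manip C V m n cnt t :
  vals C V (m + n) cnt t = vals C V m cnt t + (if manip_mask t then n else 0).
Proof. by case: t => [i|[[[a b] []]|[]]] /=; rewrite ?addn0 // addnA. Qed.

Lemma size_enc_nats l : size l <= size (enc_nats l).
Proof.
elim: l => // a l IH; rewrite /enc_nats /= size_cat size_enc_nat addSn ltnS.
by apply: leq_trans IH _; apply: leq_addl.
Qed.

Lemma manipsP (X : Type) (sz : X -> nat) (dm : X -> Prop) (C : X -> seq nat)
    (V : X -> seq (nat * seq nat)) (W : X -> seq nat) (B : X -> nat) (aux : X -> store) tr :
  (exists c k, forall x, dm x -> B x <= c * (sz x).+1 ^ k) -> untouched tr -> sJk \notin tr ->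
  triple sz (fun x s => dm x /\
       holds tr (enc_nats (W x)) (vals (C x) (V x) 0 0) (B x) (aux x) s)
    (Iter manip_body tt)
    (fun x _ s => dm x /\ holds tr [::] (vals (C x) (V x) (sumn (W x)) 0) (B x) (aux x) s).
Proof.
move=> [c [k hB]] htr trJ.
apply: (@tripleIter _ _ _ _ _ _ _ _ _ _ (fun x m (_ : unit) s => dm x /\ exists d l,
  [/\ d + sumn l = sumn (W x), m = size l &
   holds tr (enc_nats l) (vals (C x) (V x) d 0) (B x) (aux x) s]) c k).
  move=> x s [dx h]; exists (size (W x)).
    apply: leq_trans (hB x dx); case: h => cs [_ _ _ h _]; apply: leq_trans h.
    by apply: leq_trans (size_enc_nats _) _; apply: leq_addl.
  by split=> //; exists 0, (W x).
case.
pose Y := (X * (nat * seq nat))%type.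
pose szY (y : Y) := sz y.1.
pose dmY (y : Y) := dm y.1 /\ y.2.1 + sumn y.2.2 = sumn (W y.1).
pose vY (y : Y) := vals (C y.1) (V y.1) y.2.1 0.
pose BY (y : Y) := B y.1.
pose aY (y : Y) := aux y.1.
pose hd (y : Y) := head 0 y.2.2.
pose dm1 (y : Y) := dmY y /\ y.2.2 = hd y :: behead y.2.2.
have pBY : exists c k, forall y, dm1 y -> BY y <= c * (szY y).+1 ^ k.
  by exists c, k => y [[dy _] _]; apply: hB.
apply: (tripleA (szY := szY) (c0 := 1) (k0 := 1)
  (P' := fun y s => dmY y /\ holds tr (enc_nats y.2.2) (vY y) (BY y) (aY y) s)
  (Q' := fun y r s => match r with
    | inl _ => dm1 y /\ holds tr (enc_nats (behead y.2.2))
         (vals (C y.1) (V y.1) (y.2.1 + hd y) 0) (BY y) (aY y) s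
    | inr _ => [/\ dmY y, y.2.2 = [::] & holds tr [::] (vY y) (BY y) (aY y) s] end)); last first.
  move=> [x m] s [/= dx [d [l [VE -> h]]]]; exists (x, (d, l)); split=> //.
    by rewrite mul1n expn1.
  move=> [_|_] s' /=; last first.
    by move=> [_ e]; move: VE; rewrite /vY /= e addn0 => <-; split.
  move=> [[_ /= e] h']; exists (size (behead l)); first by rewrite [X in _ < size X]e.
  split=> //; exists (d + hd (x, (d, l))), (behead l); split=> //.
  by rewrite -VE [X in _ = d + sumn X]e /= addnA.
rewrite /manip_body; apply: (tripleBind (M := fun y (b : bool) s =>
    (dmY y /\ b = (y.2.2 != [::])) /\ holds tr (enc_nats y.2.2) (vY y) (BY y) (aY y) s)).
  apply: tripleE => y s [dy [cs [h1 h2 h3 h4 [h5 h6]]]] /=; rewrite h1.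
  case E: y.2.2 h1 h4 => [|a l] h1 h4 /=; first by split=> //; exists cs.
  have : 0 < size (enc_nats (a :: l)) by rewrite /enc_nats /= size_cat size_enc_nat.
  case E' : (enc_nats (a :: l)) h1 h4 => [|g gs] h1 h4 //= _.
  split=> //; exists cs.
  have -> : upd (upd s sA (map eL gs)) sA (eL g :: upd s sA (map eL gs) sA) = s.
    by apply: functional_extensionality => i; rewrite /upd eqxx; case: eqP => // ->.
  by [].
case; last first.
  apply: tripleRet => y s [[dy /esym/negbFE/eqP e] h].
  by split=> //; move: h; rewrite e.
apply: (tripleBind (M := fun y (_ : column) s => dm1 y /\ holds tr (enc_nats (behead y.2.2))
    (fun t => vY y t + (if manip_mask t then hd y else 0)) (BY y) (aY y) s)).
  apply: tripleC (addP (fun y => enc_nats (behead y.2.2)) vY aY pBY htr hd manip_mask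
     (isT : untouched [:: sJk])) _ _.
    move=> y s [[dy e] h]; have e' : y.2.2 = hd y :: behead y.2.2.
      by rewrite /hd; case: y.2.2 e.
    by split=> //; move: h; rewrite [in X in X -> _]e'.
  by move=> y r s [dy h]; split=> //; move: h; rewrite holds_upd.
move=> _; apply: tripleRet => y s [dy h]; split=> //.
by apply: holds_val h => t; rewrite vals_manip.
Qed.

Section PolyBound.
Variables (X : Type) (sz : X -> nat) (dm : X -> Prop).
Definition polyb (f : X -> nat) := exists c k, forall x, dm x -> f x <= c * (sz x).+1 ^ k.

Lemma polyb_le f g : polyb g -> (forall x, dm x -> f x <= g x) -> polyb f.
Proof. by move=> [c [k H]] le; exists c, k => x dx; apply: leq_trans (le x dx) (H x dx). Qed.

Lemma polyb_sz : polyb sz.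
Proof. by exists 1, 1 => x _; rewrite mul1n expn1. Qed.

Lemma polyb_add f g : polyb f -> polyb g -> polyb (fun x => f x + g x).
Proof.
move=> [c [k H]] [c' [k' H']]; exists (c + c'), (maxn k k') => x dx.
rewrite mulnDl leq_add //.
  by apply: leq_trans (H x dx) _; apply: poly_weaken => //; apply: leq_maxl.
by apply: leq_trans (H' x dx) _; apply: poly_weaken => //; apply: leq_maxr.
Qed.

Lemma polyb_time f c1 k1 : polyb f -> polyb (fun x => c1 * f x ^ k1 + c1).
Proof.
move=> [c [k H]]; apply: polyb_add; last by exists c1, 0 => x _; rewrite muln1.
exists (c1 * c ^ k1), (k * k1) => x dx; rewrite -mulnA leq_mul2l expnM -expnMn.
by case: k1 => [|k1]; rewrite ?orbT // leq_exp2r // H ?orbT.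
Qed.
End PolyBound.

Lemma holds_frame tr tr' w val B aux aux' s s' : holds tr w val B aux s ->
  {in [:: sA; sK; sTm], s' =1 s} -> {in tr', s' =1 aux'} -> holds tr' w val B aux' s'.
Proof.
move=> [cs [h1 h2 h3 h4 [h5 h6]]] e h; exists cs.
by rewrite !e ?inE //; split=> //.
Qed.

(** * The complete program *)

Section Algorithm.
Variables (tbC : seq nat -> seq nat) (tbP : seq nat -> seq (nat * nat)).
Variable decide : seq nat -> seq nat -> seq nat -> {ffun reg * reg -> bool} -> bool.

Definition feed1 (g : sym) : sym := if dL g is Some a then e1 (tm_in M1 a) else g.
Definition feed2 (g : sym) : sym := if dL g is Some a then e2 (tm_in M2 a) else g.

(** The order is that of the encoding, with each machine output poured in front of the unread input
    just before it is parsed. The two direct calls of [read_match] merely skip the numbers of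
    candidates and of manipulators; [j * j.-1] counts two names for each unordered pair. *)
Definition main : prog bool :=
  Bind (drain sym sIn sA) (fun _ =>
  Bind (read_match sJk) (fun _ =>
  names (enum 'I_j) (
  Bind (distribute sLg sR1 sR2 feed1 feed2) (fun _ =>
  Bind (simulate e1 d1 eL sL1 sR1 sO1) (fun _ =>
  Bind (drain sym sO1 sA) (fun _ =>
  idents j [::] (fun oC =>
  Bind (simulate e2 d2 eL sL2 sR2 sO2) (fun _ =>
  Bind (drain sym sO2 sA) (fun _ =>
  idents (j * j.-1) [::] (fun oP =>
  idents 1 [::] (fun ip =>
  Bind (read_add (pred1 rcnt) sJk) (fun _ =>
  Bind (Iter voter_body tt) (fun _ =>
  Bind (read_match sJk) (fun _ =>
  Bind (Iter manip_body tt) (fun _ =>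
  Bind compare (fun tb => Ret idx sym (decide oC oP ip tb))))))))))))))))).

Definition flat_pairs (C : seq nat) : seq nat := flatten [seq [:: x.1; x.2] | x <- tbP C].
Definition final_vals (x : inst) : reg -> nat :=
  vals (icands x) (ivoters x) (sumn (imanip x)) 0.

Variables c1 k1 c2 k2 : nat.
Hypothesis permC : forall C, uniq C -> perm_eq (tbC C) C.
Hypothesis run1 : forall C, uniq C -> runs_to M1 (enc_nats C) (enc_nats (tbC C))
  (c1 * size (enc_nats C) ^ k1 + c1).
Hypothesis run2 : forall C, uniq C -> runs_to M2 (enc_nats C) (enc_pairs (tbP C))
  (c2 * size (enc_nats C) ^ k2 + c2).
Hypothesis sizeP : forall C, uniq C -> size C = j -> size (flat_pairs C) = j * j.-1.
Hypothesis subP : forall C, uniq C -> {subset flat_pairs C <= C}.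

Let sz (x : inst) := size (enc_inst x).
Let w7 (x : inst) := enc_nats (imanip x).
Let w6 x := enc_nat (size (imanip x)) ++ w7 x.
Let w5 x := enc_voters (ivoters x) ++ w6 x.
Let w4 x := enc_nat (size (ivoters x)) ++ w5 x.
Let w3 x := enc_nats [:: idist x] ++ w4 x.
Let w2 x := enc_nats (icands x) ++ w3 x.

Lemma enc_inst_split x : enc_inst x = enc_nat (size (icands x)) ++ w2 x.
Proof.
rewrite /w2 /w3 /w4 /w5 /w6 /w7 /enc_inst /enc_voters /enc_nats /=.
by rewrite !map_cat !flatten_cat /= map_cat flatten_cat /= -!catA.
Qed.

Let val0 (x : inst) : reg -> nat := vals (icands x) [::] 0 0.
(** The stacks whose contents still matter: before the log is distributed, after that, after the
    first simulated machine, and after the second. *)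
Let tr0 := [:: sLg; sL1; sR1; sO1; sL2; sR2; sO2; sWt].
Let tr1 := [:: sL1; sR1; sO1; sL2; sR2; sO2; sWt].
Let tr2 := [:: sO1; sL2; sR2; sO2; sWt].
Let tr3 := [:: sO2; sWt].
Let none : store := fun _ => [::].
Let in2 (x : inst) := map (fun a => e2 (tm_in M2 a)) (enc_nats (icands x)).
Let out1 x := enc_nats (tbC (icands x)).
Let out2 x := enc_nats (flat_pairs (icands x)).
Let B1 x := sz x + size (out1 x).
Let B2 x := B1 x + size (out2 x).

Lemma mainP : triple sz (fun x s => wf_inst j x /\ s = input_store sIn eL (enc_inst x)) main
  (fun x b _ => wf_inst j x /\ b = decide [seq index c (icands x) | c <- tbC (icands x)]
     [seq index c (icands x) | c <- flat_pairs (icands x)] [:: index (idist x) (icands x)]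
     [ffun p => final_vals x p.1 <= final_vals x p.2]).
Proof.
have wfC x : wf_inst j x -> uniq (icands x) /\ size (icands x) = j by case.
have szC x : size (enc_nats (icands x)) <= sz x.
  by rewrite /sz enc_inst_split /w2 !size_cat addnCA leq_addr.
have pB0 : polyb sz (wf_inst j) sz by apply: polyb_sz.
have pt1 : polyb sz (wf_inst j) (fun x => size (enc_nats (icands x)) +
    (c1 * size (enc_nats (icands x)) ^ k1 + c1)).
  by apply: polyb_add; [|apply: polyb_time]; apply: polyb_le pB0 _ => x _.
have pt2 : polyb sz (wf_inst j) (fun x => size (enc_nats (icands x)) +
    (c2 * size (enc_nats (icands x)) ^ k2 + c2)).
  by apply: polyb_add; [|apply: polyb_time]; apply: polyb_le pB0 _ => x _.
have p1 : polyb sz (wf_inst j) (fun=> 1) by exists 1, 0 => x _; rewrite muln1.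
have po1 : polyb sz (wf_inst j) (fun x => size (out1 x)).
  by apply: polyb_le (polyb_add pt1 p1) _ => x /wfC [uC _]; apply: runs_to_size (run1 uC).
have po2 : polyb sz (wf_inst j) (fun x => size (out2 x)).
  by apply: polyb_le (polyb_add pt2 p1) _ => x /wfC [uC _]; apply: runs_to_size (run2 uC).
have pB1 : polyb sz (wf_inst j) B1 by apply: polyb_add.
have pB2 : polyb sz (wf_inst j) B2 by apply: polyb_add.
have sub (f : inst -> nat) (dm : inst -> Prop) : polyb sz (wf_inst j) f ->
    (forall x, dm x -> wf_inst j x) -> polyb sz dm f.
  by move=> [c [k H]] le; exists c, k => x /le; apply: H.
apply: (tripleBind (M := fun x (_ : unit) s => wf_inst j x /\
    holds tr0 (enc_nat (size (icands x)) ++ w2 x) (fun=> 0) (sz x) none s)).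
  apply: (tripleA (c0 := 1) (k0 := 1) (drainP sym (isT : sIn != sA))).
  move=> x s [wx ->]; eexists; split; first by [].
    by rewrite /input_store eqxx size_rev size_map mul1n expn1.
  move=> _ s' ->; split=> //; exists [::]; split=> //.
  - by rewrite upd_eq /input_store eqxx catrevE revK cats0 enc_inst_split.
  - by rewrite /sz -enc_inst_split.
  split=> // k; rewrite !inE; do 7![case/orP => [/eqP ->//|]]; by move/eqP ->.
move=> _; apply: (tripleBind (M := fun x (_ : column) s => wf_inst j x /\
    holds tr0 (w2 x) (fun=> 0) (sz x) none s)).
  apply: tripleC (matchP w2 (fun x t => 0) (fun=> none) pB0 (isT : untouched tr0)
    (fun x => size (icands x)) (isT : untouched [:: sJk])) _ _ => //.
  by move=> x r s [[wx _] h]; split=> //; move: h; rewrite holds_upd.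
move=> _.
have mapC x : wf_inst j x -> [seq nth 0 (icands x) i | i : 'I_j <- enum 'I_j] = icands x.
  move=> /wfC [_ sC]; rewrite -[in RHS](mkseq_nth 0 (icands x)) sC /mkseq -val_enum_ord.
  by rewrite -map_comp.
apply: (tripleC (P' := fun x s => wf_inst j x /\
    holds tr0 (enc_nats [seq nth 0 (icands x) i | i : 'I_j <- enum 'I_j] ++ w3 x)
      (fun=> 0) (sz x) none s) _ _ (fun x r s h => h)); last first.
  by move=> x s [wx h]; rewrite mapC.
apply: (namesP pB0 (isT : untouched tr0)).
pose in1 (x : inst) := map (fun a => e1 (tm_in M1 a)) (enc_nats (icands x)).
pose aux1 x := upd (upd none sR1 (in1 x)) sR2 (in2 x).
apply: (tripleBind (M := fun x (_ : unit) s => wf_inst j x /\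
    holds tr1 (w3 x) (val0 x) (sz x) (aux1 x) s)).
  apply: (tripleA (c0 := 1) (k0 := 1) (@distributeP idx sym sLg sR1 sR2 feed1 feed2 isT isT isT)).
  move=> x s [wx h]; move: (h) => [cs [_ _ _ _ [_ hs]]].
  have sL : s sLg = rev (map eL (enc_nats (icands x))).
    by rewrite hs ?inE // upd_eq mapC // catrevE cats0.
  exists s; split=> //.
    by rewrite sL size_rev size_map mul1n expn1; apply: leqW.
  move=> _ s' ->; split=> //; apply: (holds_frame (tr := tr0)).
  - apply: holds_val h => t; rewrite add0n /val0 big_enum /=.
    case: t => [i|[[[a b] e]|[]]] /=.
    + rewrite (bigD1 i) //= eqxx big1 ?addn0 // => i' ne.
      by case: eqP => // -[e]; rewrite e eqxx in ne.
    + by rewrite big1 // /wsum big_nil if_same.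
    + by rewrite big1.
  - by move=> k; rewrite !inE; do 2![case/orP => [/eqP ->//|]]; move/eqP->.
  - move=> k; rewrite !inE; do ?[case/orP]; move/eqP->.
    + by rewrite !upd_ne // hs.
    + rewrite /aux1 upd_ne // upd_eq upd_ne // upd_eq (hs sR1) // upd_ne //.
      by rewrite sL catrevE cats0 map_rev revK -map_comp.
    + by rewrite !upd_ne // hs.
    + by rewrite !upd_ne // hs.
    + rewrite /aux1 !upd_eq (hs sR2) // upd_ne //.
      by rewrite sL catrevE cats0 map_rev revK -map_comp.
    + by rewrite !upd_ne // hs.
    + by rewrite !upd_ne // hs.
move=> _.
pose aux2 x := upd (upd none sR2 (in2 x)) sO1 (rev (map eL (out1 x))).
apply: (tripleBind (M := fun x (_ : unit) s => wf_inst j x /\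
    holds tr2 (w3 x) (val0 x) (sz x) (aux2 x) s)).
  have [c [k hck]] := pt1.
  apply: (tripleA (c0 := c) (k0 := k)
    (@simulateP idx sym M1 e1 d1 eL (fun=> erefl) sL1 sR1 sO1 isT)).
  move=> x s [wx h]; move: (h) => [cs [_ _ _ _ [_ hs]]]; have [uC _] := wfC _ wx.
  exists (s, enc_nats (icands x), out1 x, c1 * size (enc_nats (icands x)) ^ k1 + c1); split=> //.
  - split=> //; first exact: run1.
    + by rewrite hs.
    + by rewrite hs.
    + by rewrite hs.
  - exact: hck.
  move=> _ s' [so fr]; split=> //; apply: (holds_frame h).
  - by move=> k0; rewrite !inE; do ?[case/orP]; move/eqP->; apply: fr.
  - move=> k0; rewrite !inE; do ?[case/orP]; move/eqP->; first by rewrite so /aux2 upd_eq.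
    + by rewrite fr // hs.
    + by rewrite fr // hs.
    + by rewrite fr // hs.
    + by rewrite fr // hs.
move=> _.
pose aux3 x := upd none sR2 (in2 x).
apply: (tripleBind (M := fun x (_ : unit) s => wf_inst j x /\
    holds tr2 (out1 x ++ w3 x) (val0 x) (B1 x) (aux3 x) s)).
  apply: tripleC (undrainP w3 (u := out1) val0 sz aux2 (isT : untouched tr2) (isT : sO1 != sA) isT po1) _ _.
    by move=> x s [wx h]; split=> //; split=> //; rewrite /aux2 upd_eq.
  move=> x r s [wx h]; split=> //; apply: holds_aux h => k _.
  by rewrite /aux2 /aux3 /upd; case: eqP => // ->.
move=> _.
have wfv x : wf_inst j x -> [/\ uniq (icands x), size (icands x) = j & idist x \in icands x] by case.
apply: (@identsP _ inst sz w3 val0 B1 aux3 tr2 icands _ _ isT isT j (wf_inst j) (fun x => tbC (icands x)) [::] pB1).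
  move=> x /wfC [uC sC]; have p := permC uC; split=> //.
    by rewrite (perm_size p).
  by move=> z; rewrite (perm_mem p).
move=> oC.
pose dmC x := wf_inst j x /\ oC = [seq index c (icands x) | c <- tbC (icands x)].
have dmCW x : dmC x -> wf_inst j x by case.
pose aux4 x := upd none sO2 (rev (map eL (out2 x))).
apply: (tripleBind (M := fun x (_ : unit) s => dmC x /\
    holds tr3 (w3 x) (val0 x) (B1 x) (aux4 x) s)).
  have [c [k hck]] := pt2.
  apply: (tripleA (c0 := c) (k0 := k)
    (@simulateP idx sym M2 e2 d2 eL (fun=> erefl) sL2 sR2 sO2 isT)).
  move=> x s [dx h]; move: (h) => [cs [_ _ _ _ [_ hs]]].
  have wx := dmCW _ dx; have [uC _] := wfC _ wx.
  exists (s, enc_nats (icands x), out2 x, c2 * size (enc_nats (icands x)) ^ k2 + c2); split=> //.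
  - split=> //; first exact: run2.
    + by rewrite hs.
    + by rewrite hs.
    + by rewrite hs.
  - exact: hck.
  move=> _ s' [so fr]; split=> //; apply: (holds_frame h).
  - by move=> k0; rewrite !inE; do ?[case/orP]; move/eqP->; apply: fr.
  - move=> k0; rewrite !inE; do ?[case/orP]; move/eqP->; first by rewrite so /aux4 upd_eq.
    by rewrite fr // hs.
move=> _.
apply: (tripleBind (M := fun x (_ : unit) s => dmC x /\
    holds tr3 (out2 x ++ w3 x) (val0 x) (B2 x) none s)).
  apply: tripleC (undrainP w3 (u := out2) val0 B1 aux4 (isT : untouched tr3) (isT : sO2 != sA) isT
    (sub _ _ po2 dmCW)) _ _.
    by move=> x s [wx h]; split=> //; split=> //; rewrite /aux4 upd_eq.
  move=> x r s [wx h]; split=> //; apply: holds_aux h => k _.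
  by rewrite /aux4 /upd; case: eqP => // ->.
move=> _.
apply: (@identsP _ inst sz w3 val0 B2 (fun=> none) tr3 icands _ _ isT isT (j * j.-1) dmC
  (fun x => flat_pairs (icands x)) [::] (sub _ _ pB2 dmCW)).
  by move=> x /dmCW /wfC [uC sC]; split=> //; [apply: sizeP|apply: subP].
move=> oP.
pose dmP x := dmC x /\ oP = [seq index c (icands x) | c <- flat_pairs (icands x)].
have dmPW x : dmP x -> wf_inst j x by case=> /dmCW.
apply: (@identsP _ inst sz w4 val0 B2 (fun=> none) tr3 icands _ _ isT isT 1 dmP
  (fun x => [:: idist x]) [::] (sub _ _ pB2 dmPW)).
  by move=> x /dmPW /wfv [uC sC p]; split=> // z; rewrite inE => /eqP ->.
move=> ip.
pose dmI x := dmP x /\ ip = [:: index (idist x) (icands x)].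
have dmIW x : dmI x -> wf_inst j x by case=> /dmPW.
have pBI := sub _ _ pB2 dmIW.
apply: (tripleBind (M := fun x (_ : column) s => dmI x /\
    holds tr3 (w5 x) (vals (icands x) [::] 0 (size (ivoters x))) (B2 x) none s)).
  apply: tripleC (addP w5 val0 (fun=> none) pBI (isT : untouched tr3) (fun x => size (ivoters x))
     (pred1 rcnt) (isT : untouched [:: sJk])) _ _ => //.
  move=> x r s [dx h]; split=> //; move: h; rewrite holds_upd // => h.
  by apply: holds_val h => -[i|[[[a b] e]|[]]] /=; rewrite ?addn0.
move=> _.
have Hv x : dmI x -> [/\ uniq (icands x), size (icands x) = j,
    all (fun v => perm_eq v.2 (icands x)) (ivoters x) & none sWt = [::]].
  by move=> /dmIW [h1 h2 h3 h4].
apply: (tripleBind (@votersP inst sz dmI icands ivoters w6 B2 (fun=> none) tr3 pBI isT isT isT Hv)).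
move=> _.
apply: (tripleBind (M := fun x (_ : column) s => dmI x /\
    holds tr3 (w7 x) (vals (icands x) (ivoters x) 0 0) (B2 x) none s)).
  apply: tripleC (matchP w7 (fun x => vals (icands x) (ivoters x) 0 0) (fun=> none) pBI
    (isT : untouched tr3) (fun x => size (imanip x)) (isT : untouched [:: sJk])) _ _ => //.
  by move=> x r s [[dx _] h]; split=> //; move: h; rewrite holds_upd.
move=> _.
apply: (tripleBind (@manipsP inst sz dmI icands ivoters imanip B2 (fun=> none) tr3 pBI isT isT)) => _.
apply: (tripleBind (@compareP inst sz dmI (fun=> [::]) final_vals B2 (fun=> none) tr3 pBI isT)) => tb.
by apply: tripleRet => x s [[[[wx ->] ->] ->] ->].
Qed.

End Algorithm.
End Main.

(** * Ranked pairs *)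

Import Order.TTheory GRing.Theory Num.Theory.

Inductive tc (F : seq (nat * nat)) (a b : nat) : Prop :=
  | tc1 of (a, b) \in F
  | tcS c of (a, c) \in F & tc F c b.

Lemma tc_trans F a b c : tc F a b -> tc F b c -> tc F a c.
Proof. by elim=> {a b} [a b ab bc|a b d ad _ IH /IH]; [apply: tcS bc|apply: tcS]. Qed.

Lemma tc_sub (F F' : seq (nat * nat)) a b : {subset F <= F'} -> tc F a b -> tc F' a b.
Proof. by move=> s; elim=> {a b} [a b /s|a b c /s ac _]; [apply: tc1|apply: tcS]. Qed.

Lemma reach_tc F k a b : reach F k a b -> tc F a b.
Proof.
elim: k a => //= k IH a /hasP[[x y] xy /= /andP[/eqP <- /orP[/eqP <-|/IH]]]; first exact: tc1.
exact: tcS.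
Qed.

Lemma path_reach F k a p : path (fun x y => (x, y) \in F) a p -> p != [::] -> size p <= k ->
  reach F k a (last a p).
Proof.
elim: k a p => [|k IH] a [|b p] //= /andP[ab pp] _ sp; apply/hasP; exists (a, b) => //=.
rewrite eqxx /=; case: p pp sp => [|c p] pp sp; first by rewrite eqxx.
by apply/orP; right; apply: (IH b (c :: p)).
Qed.

Lemma above_tc F a b : above F a b -> tc F a b.
Proof. exact: reach_tc. Qed.

(** The fuel [size F] suffices: a path without repeated vertices uses distinct edges of [F]. *)
Lemma tc_above F a b : tc F a b -> a != b -> above F a b.
Proof.
move=> t ab; pose e := fun x y => (x, y) \in F.
have [p pp lp] : exists2 p, path e a p & last a p = b.
  elim: t => {a b ab} [a b ab|a b c ac _ [p pp lp]]; first by exists [:: b]; rewrite //= /e ab.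
  by exists (c :: p); rewrite //= /e ac.
case/shortenP: pp lp => q qp uq _ lq; rewrite -lq; apply: path_reach => //.
  by apply: contraNneq ab => q0; rewrite -lq q0.
(* The edges of the path; they are distinct because their targets are. *)
pose s := zip (belast a q) q.
have sq : size s = size q by rewrite size2_zip // size_belast.
rewrite -sq; apply: uniq_leq_size.
  apply: (@map_uniq _ _ snd); rewrite -/(unzip2 s) unzip2_zip ?size_belast //.
  by case/andP: uq.
rewrite /s; elim: q a qp {ab uq lq s sq t} => //= c q IH a /andP[ac cq] x.
by rewrite inE => /orP[/eqP -> //|]; apply: IH.
Qed.

Definition acyclic F := forall a, ~ tc F a a.

Lemma tc_cons F x y a b : tc ((x, y) :: F) a b ->
  tc F a b \/ (a = x \/ tc F a x) /\ (b = y \/ tc F y b).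
Proof.
elim=> {a b} [a b|a b c].
  by rewrite inE => /orP[/eqP[-> ->]|]; [right; split; left|left; apply: tc1].
rewrite inE => /orP[/eqP[-> ->] _ [yb|[_ yb]]|ac _ [cb|[cx yb]]].
- by right; split; [left|right].
- by right; split; [left|].
- by left; apply: tcS cb.
right; split=> //; right; case: cx => [<-|]; [exact: tc1|exact: tcS].
Qed.

Lemma acyclic_cons F x y : acyclic F -> x != y -> ~ tc F y x -> acyclic ((x, y) :: F).
Proof.
move=> aF /eqP xy yx a /tc_cons[/aF //|[ax ya]].
case: ax => ax; case: ya => ya; subst=> //.
by apply: yx; apply: tc_trans ya ax.
Qed.

Lemma mem_allupairs C a b : ((a, b) \in allupairs C) = [&& a \in C, b \in C & a < b].
Proof.
apply/allpairsPdep/and3P => [[x [y [xC]]]|[aC bC ab]].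
  by rewrite mem_filter => /andP[xy yC] [-> ->].
by exists a, b; rewrite mem_filter ab.
Qed.

Lemma upair_swap a b : upair (a, b) = upair (b, a).
Proof. by rewrite /upair /= minnC maxnC. Qed.

Lemma upair_lt a b : a < b -> upair (a, b) = (a, b).
Proof. by move=> ab; rewrite /upair /= (minn_idPl (ltnW ab)) (maxn_idPr (ltnW ab)). Qed.

Lemma upairP a b : upair (a, b) = (a, b) \/ upair (a, b) = (b, a).
Proof.
by case: (ltngtP a b) => [h|h|->]; [left; apply: upair_lt|right; rewrite upair_swap upair_lt|left; rewrite /upair /= minnn maxnn].
Qed.

Lemma upair_eq a b c d : upair (a, b) = upair (c, d) -> a = c /\ b = d \/ a = d /\ b = c.
Proof. by case: (upairP a b) => ->; case: (upairP c d) => -> [-> ->]; auto. Qed.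

Lemma mem_upair C a b : a \in C -> b \in C -> a != b -> upair (a, b) \in allupairs C.
Proof.
move=> aC bC ab; case: (ltngtP a b) ab => // h _; first by rewrite upair_lt // mem_allupairs aC bC.
by rewrite upair_swap upair_lt // mem_allupairs aC bC.
Qed.

Lemma wmgN E a b : wmg E b a = (- wmg E a b)%R.
Proof. by rewrite /wmg -sumrN; apply: eq_bigr => x _; rewrite opprB. Qed.

(** * A single run *)

Section Run.
Variables (C : seq nat) (E : seq (nat * seq nat)) (ordC : seq nat) (ordP : seq (nat * nat)).
Local Notation D := (wmg E).

Definition directed a b : bool :=
  (0 < D a b)%R || ((D a b == 0) && (index a ordC < index b ordC)).

Definition good_orders := [/\ uniq C, perm_eq ordC C & perm_eq (map upair ordP) (allupairs C)].

Local Notation before := (rp_before E ordP).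

Lemma strength_swap a b : rp_strength E (a, b) = rp_strength E (b, a).
Proof. by rewrite /rp_strength /= maxC. Qed.

Lemma before_swapl a b z : before (a, b) z = before (b, a) z.
Proof. by rewrite /rp_before strength_swap /rp_pairpos upair_swap. Qed.

Lemma before_swapr a b z : before z (a, b) = before z (b, a).
Proof. by rewrite /rp_before strength_swap /rp_pairpos upair_swap. Qed.

Lemma before_upairl a b z : before (upair (a, b)) z = before (a, b) z.
Proof. by case: (upairP a b) => ->; rewrite // before_swapl. Qed.

Lemma before_upairr a b z : before z (upair (a, b)) = before z (a, b).
Proof. by case: (upairP a b) => ->; rewrite // before_swapr. Qed.

Lemma before_total : total before.
Proof. by move=> x y; rewrite /rp_before; case: ltgtP => //= _; apply: leq_total. Qed.

Lemma before_trans : transitive before.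
Proof.
move=> y x z; rewrite /rp_before => /orP[h1|/andP[/eqP e1 p1]] /orP[h2|/andP[/eqP e2 p2]].
- by rewrite (lt_trans h2 h1).
- by rewrite -e2 h1.
- by rewrite e1 h2.
- by rewrite e1 e2 eqxx (leq_trans p1 p2) orbT.
Qed.

Hypothesis good : good_orders.

Lemma before_anti x y : x \in allupairs C -> y \in allupairs C -> before x y -> before y x -> x = y.
Proof.
case: good => _ _ pP xC yC; rewrite /rp_before => /orP[h1|/andP[/eqP e1 p1]] /orP[h2|/andP[/eqP e2 p2]].
- by have := lt_trans h1 h2; rewrite ltxx.
- by rewrite e2 ltxx in h1.
- by rewrite e1 ltxx in h2.
have e : rp_pairpos ordP x = rp_pairpos ordP y by apply/eqP; rewrite eqn_leq p1.
have U z : z \in allupairs C -> upair z = z.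
  by case: z => a b; rewrite mem_allupairs => /and3P[_ _]; apply: upair_lt.
move: e; rewrite /rp_pairpos !U // => e.
by rewrite -(nth_index (0, 0) (s := map upair ordP) (x := x)) ?(perm_mem pP) // e nth_index // (perm_mem pP).
Qed.

Lemma directedN a b : a \in C -> b \in C -> a != b -> directed b a = ~~ directed a b.
Proof.
case: good => uC pC _ aC bC ab; rewrite /directed (wmgN E a b) oppr_gt0 oppr_eq0.
case: ltgtP => //= _; rewrite -leqNgt [RHS]leq_eqVlt.
suff -> : (index b ordC == index a ordC) = false by [].
apply/eqP => e; case/negP: ab; apply/eqP.
by rewrite -(nth_index 0 (s := ordC) (x := a)) ?(perm_mem pC) // -e nth_index // (perm_mem pC).
Qed.

Local Notation step := (rp_step E ordC).

Lemma stepE F a b : rp_step E ordC F (a, b) =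
  if above F a b || above F b a then F
  else (if directed a b then (a, b) else (b, a)) :: F.
Proof.
rewrite /rp_step /directed (wmgN E a b) oppr_gt0; case: ifP => // _.
by case: ltgtP => //= _; case: ifP.
Qed.

Definition proper_pairs (ps : seq (nat * nat)) :=
  forall a b, (a, b) \in ps -> [/\ a \in C, b \in C & a < b].

(** Stated for arbitrary lists of pairs because it is applied to prefixes of the sorted list, that
    is, in the middle of a run. *)
Lemma run_inv ps : proper_pairs ps -> let F := foldl step [::] ps in
  [/\ acyclic F,
      (forall a b, (a, b) \in F ->
         [/\ a \in C, b \in C, a != b, directed a b & upair (a, b) \in ps]) &
      (forall a b, upair (a, b) \in ps -> tc F a b \/ tc F b a)].
Proof.
elim/last_ind: ps => [|ps [x y] IH] pp /=.
  split=> //; move=> a; by elim.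
have pps : proper_pairs ps by move=> a b h; apply: pp; rewrite mem_rcons inE h orbT.
have [xC yC xy] : [/\ x \in C, y \in C & x < y] by apply: pp; rewrite mem_rcons mem_head.
have nxy : x != y by rewrite neq_ltn xy.
have [aF eF tF] := IH pps; rewrite foldl_rcons stepE; set F := foldl _ _ _ in aF eF tF *.
have up a b : upair (a, b) \in rcons ps (x, y) ->
    upair (a, b) \in ps \/ ((a = x /\ b = y) \/ (a = y /\ b = x)).
  rewrite mem_rcons inE => /orP[/eqP e|]; [right; move: e|by left].
  by case: (upairP a b) => -> [-> ->]; [left|right].
case: ifP => [ab|/negbT]; last rewrite negb_or => /andP[nab nba].
  split=> //.
    by move=> a b /eF[h1 h2 h3 h4 h5]; split=> //; rewrite mem_rcons inE h5 orbT.
  move=> a b /up[/tF //|ab'].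
  by case/orP: ab => /above_tc t; case: ab' => -[-> ->]; auto.
have nt : ~ tc F x y by move=> /tc_above /(_ nxy); rewrite (negbTE nab).
have nt' : ~ tc F y x.
  by move=> /tc_above; rewrite eq_sym (negbTE nba) => /(_ nxy).
have sub z : {subset F <= z :: F} by move=> u uF; rewrite inE uF orbT.
split.
- by case: ifP => _; apply: acyclic_cons => //; rewrite eq_sym.
- move=> a b; rewrite inE => /orP[|/eF[h1 h2 h3 h4 h5]]; last first.
    by split=> //; rewrite mem_rcons inE h5 orbT.
  case: ifP => d /eqP[-> ->]; split=> //.
  + by rewrite upair_lt // mem_rcons mem_head.
  + by rewrite eq_sym.
  + by rewrite directedN // d.
  + by rewrite upair_swap upair_lt // mem_rcons mem_head.
- move=> a b /up[/tF [t|t]|[[-> ->]|[-> ->]]].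
  + by left; apply: tc_sub t.
  + by right; apply: tc_sub t.
  + by case: ifP => _; [left|right]; apply: tc1; rewrite mem_head.
  + by case: ifP => _; [right|left]; apply: tc1; rewrite mem_head.
Qed.

Lemma run_mono F ps : {subset F <= foldl step F ps}.
Proof.
elim: ps F => [|[a b] ps IH] F // x xF; apply: (IH (step F (a, b))); rewrite stepE.
by case: ifP => // _; rewrite inE xF orbT.
Qed.

Local Notation F := (rp_fixed C E ordC ordP).
Local Notation ps := (rp_sorted_pairs C E ordP).

Lemma mem_sorted_pairs x : (x \in ps) = (x \in allupairs C).
Proof. by rewrite mem_sort. Qed.

Lemma sorted_proper : proper_pairs ps.
Proof. by move=> a b; rewrite mem_sorted_pairs mem_allupairs => /and3P. Qed.

Lemma fixed_acyclic : acyclic F. Proof. by case: (run_inv sorted_proper). Qed.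

Lemma fixed_total a b : a \in C -> b \in C -> a != b -> tc F a b \/ tc F b a.
Proof.
move=> aC bC ab; case: (run_inv sorted_proper) => _ _; apply.
by rewrite mem_sorted_pairs mem_upair.
Qed.

Lemma sorted_pairs_pairwise : pairwise before ps.
Proof. by rewrite -sorted_pairwise; [apply: sort_sorted before_total _|exact: before_trans]. Qed.

Lemma sorted_split z : z \in ps -> exists p1 p2, [/\ ps = p1 ++ z :: p2,
  {in p1, forall y, before y z} & {in p2, forall y, before z y}].
Proof.
move=> zp; have := sorted_pairs_pairwise.
case/splitPr: zp => p1 p2; rewrite pairwise_cat /= => /and3P[/allrelP h1 _ /andP[/allP h2 _]].
by exists p1, p2; split=> // y yp; apply: h1 => //; rewrite mem_head.
Qed.

Lemma proper_cat p1 p2 : proper_pairs (p1 ++ p2) -> proper_pairs p1.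
Proof. by move=> h a b ab; apply: h; rewrite mem_cat ab. Qed.

(** [F1] is the set of edges fixed just before the pair of [a] and [b] came up. Had the pair not
    been implied by then, it would have been fixed as [(b, a)], contradicting the final order. *)
Lemma implied_before a b : a \in C -> b \in C -> a != b -> tc F a b -> directed b a ->
  exists2 F1, tc F1 a b & forall c d, (c, d) \in F1 ->
    [/\ c \in C, d \in C, c != d, directed c d & (c, d) \in F /\ before (c, d) (a, b)].
Proof.
move=> aC bC ab tab dba.
have zp : upair (a, b) \in ps by rewrite mem_sorted_pairs mem_upair.
have [p1 [p2 [pE b1 b2]]] := sorted_split zp.
have pp1 : proper_pairs p1 by apply: (proper_cat (p2 := upair (a, b) :: p2)); rewrite -pE; apply: sorted_proper.
have [aF1 eF1 tF1] := run_inv pp1; set F1 := foldl _ _ _ in aF1 eF1 tF1.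
have FE : F = foldl step (step F1 (upair (a, b))) p2 by rewrite /rp_fixed pE foldl_cat.
have s1 : {subset F1 <= F}.
  by move=> x xF; rewrite FE; apply: run_mono; case: (upair _) => u v; rewrite stepE; case: ifP => // _; rewrite inE xF orbT.
have nba : ~ tc F b a by move=> t; apply: (fixed_acyclic (a := a)); apply: tc_trans t.
exists F1; last first.
  move=> c d cd; have [h1 h2 h3 h4 h5] := eF1 _ _ cd; split=> //; split; first exact: s1.
  by have := b1 _ h5; rewrite before_upairl before_upairr.
have key : above F1 a b || above F1 b a.
  apply/negPn/negP => nd; apply: nba; apply: tc1; rewrite FE; apply: run_mono.
  have nd' : above F1 b a || above F1 a b = false by rewrite orbC; apply: negbTE.
  case: (upairP a b) => ->; rewrite stepE ?(negbTE nd) ?nd' ?dba ?mem_head //.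
  by have := directedN aC bC ab; rewrite dba => /esym/negbTE ->; rewrite mem_head.
case/orP: key => /above_tc // t; case: nba; exact: tc_sub t.
Qed.

End Run.

(** * Comparison of two runs along a renaming *)

Section TwoRuns.
Variables (C : seq nat) (E : seq (nat * seq nat)) (ordC : seq nat) (ordP : seq (nat * nat)).
Variables (C' : seq nat) (E' : seq (nat * seq nat)) (ordC' : seq nat) (ordP' : seq (nat * nat)).
Hypotheses (good : good_orders C ordC ordP) (good' : good_orders C' ordC' ordP').
Variable phi : nat -> nat.
Hypotheses (injphi : {in C &, injective phi}) (phiC : C' = map phi C).
Local Notation F := (rp_fixed C E ordC ordP).
Local Notation F' := (rp_fixed C' E' ordC' ordP').

(** Only a pair that the second election directs against the first ranking can make the runs differ.
    Such a pair must already be so directed in the first election, where it was then implied by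
    earlier edges; [before_fwd] keeps these edges earlier in the second run. *)
Hypothesis directed_back : forall a b, a \in C -> b \in C -> a != b -> tc F a b ->
  directed E' ordC' (phi b) (phi a) -> directed E ordC b a.
Hypothesis before_fwd : forall a b c d, a \in C -> b \in C -> a != b -> tc F a b ->
  directed E' ordC' (phi b) (phi a) ->
  c \in C -> d \in C -> c != d -> tc F c d -> directed E ordC c d ->
  rp_before E ordP (c, d) (a, b) -> rp_before E' ordP' (phi c, phi d) (phi a, phi b).

Let inC' c : c \in C -> phi c \in C'. Proof. by move=> cC; rewrite phiC map_f. Qed.

Let phi_neq a b : a \in C -> b \in C -> a != b -> phi a != phi b.
Proof. by move=> aC bC; apply: contra_neq; apply: injphi. Qed.

Let pulled (G : seq (nat * nat)) := forall x y, (x, y) \in G ->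
  exists a b, [/\ a \in C, b \in C, tc F a b, x = phi a & y = phi b].

Let pulled_tc G a b : pulled G -> a \in C -> b \in C -> tc G (phi a) (phi b) -> tc F a b.
Proof.
move=> pG aC bC t.
suff : forall x y, tc G x y -> exists a b, [/\ a \in C, b \in C, tc F a b, x = phi a & y = phi b].
  by move=> /(_ _ _ t)[a' [b' [a'C b'C t' /injphi ea /injphi eb]]]; rewrite ea // eb.
move=> x y; elim=> {x y t} [x y /pG //|x y z /pG [u [v [uC vC uv -> ->]]] _ [v' [w [v'C wC vw e ->]]]].
by exists u, w; split=> //; apply: tc_trans uv _; rewrite (injphi _ _ e).
Qed.

(* Invariant of the second run: it never contradicts the final ranking of the first. *)
Lemma second_run_pulled : pulled F'.
Proof.
rewrite /rp_fixed.
suff H p1 p2 : rp_sorted_pairs C' E' ordP' = p1 ++ p2 -> pulled (foldl (rp_step E' ordC') [::] p1).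
  by apply: (H _ [::]); rewrite cats0.
elim/last_ind: p1 p2 => [|p1 [x y] IH] p2 pE; first by move=> x y.
have [] : [/\ (x, y) \in rp_sorted_pairs C' E' ordP' & pulled (foldl (rp_step E' ordC') [::] p1)].
  by split; [rewrite pE mem_cat mem_rcons mem_head|apply: (IH ((x, y) :: p2)); rewrite -cat_rcons].
rewrite mem_sorted_pairs mem_allupairs => /and3P[xC yC xy] pG; rewrite foldl_rcons stepE.
set G := foldl _ _ _ in pG *.
move: xC yC; rewrite phiC => /mapP[a aC ex] /mapP[b bC ey]; subst x y.
have ab : a != b by apply: contraTneq xy => ->; rewrite ltnn.
have nphi := phi_neq aC bC ab.
case: ifP => [//|/negbT]; rewrite negb_or => /andP[nab nba].
have nt : ~ tc G (phi a) (phi b) by move=> /tc_above /(_ nphi); rewrite (negbTE nab).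
have nt' : ~ tc G (phi b) (phi a).
  by move=> /tc_above; rewrite eq_sym (negbTE nba) => /(_ nphi).
have pp1 : proper_pairs C' p1.
  apply: (@proper_cat _ _ ((phi a, phi b) :: p2)).
  by rewrite -cat_rcons -pE; apply: sorted_proper.
have [aG eG tG] := run_inv E' good' pp1.
(* A pair about to be fixed against the first ranking is in fact already implied: the edges that
   implied it in the first run belong to pairs processed in [p1], and these were decided the same
   way. *)
have wrong u v : u \in C -> v \in C -> u != v -> tc F u v -> directed E' ordC' (phi v) (phi u) ->
    upair (phi u, phi v) = (phi a, phi b) -> tc G (phi u) (phi v).
  move=> uC vC uv tuv d up.
  have [F1 t1 eF1] := implied_before good uC vC uv tuv (directed_back uC vC uv tuv d).
  have : forall c e, tc F1 c e -> tc G (phi c) (phi e).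
    have eG1 c e : (c, e) \in F1 -> tc G (phi c) (phi e).
      move=> ce; have [cC eC nce dce [ceF bce]] := eF1 _ _ ce.
      have tce : tc F c e by apply: tc1.
      have bf := before_fwd uC vC uv tuv d cC eC nce tce dce bce.
      have inp : upair (phi c, phi e) \in p1.
        have inU : upair (phi c, phi e) \in allupairs C'.
          by apply: mem_upair; rewrite ?inC' ?phi_neq.
        (* An edge implying the pair is not the pair itself: with the same orientation it would
           contradict the direction of the pair, with the opposite one it would close a cycle. *)
        have nz : upair (phi c, phi e) <> (phi a, phi b).
          rewrite -up => /upair_eq[[/injphi ec /injphi ee]|[/injphi ec /injphi ee]].
            have := directedN E good uC vC uv; rewrite (directed_back uC vC uv tuv d).
            by rewrite -(ec cC uC) -(ee eC vC) dce.
          apply: (fixed_acyclic (E := E) good (a := u)); apply: tc_trans tuv _.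
          by rewrite -(ec cC vC) -(ee eC uC).
        have := inU; rewrite -(mem_sorted_pairs C' E' ordP') pE mem_cat mem_rcons inE.
        case/orP=> [/orP[/eqP//|//]|in2]; case: nz.
        apply: (before_anti (E := E') good') => //.
        - by rewrite -up; apply: mem_upair; rewrite ?inC' ?phi_neq.
        - by rewrite -up before_upairl before_upairr.
        - have := sorted_pairs_pairwise C' E' ordP'; rewrite pE pairwise_cat => /and3P[/allrelP h _ _].
          by apply: h in2; rewrite mem_rcons mem_head.
      (* The processed pair is decided in [G]; the opposite order would pull back to a cycle in the
         first ranking. *)
      case: (tG _ _ inp) => // /(pulled_tc pG eC cC) tec.
      by case: (fixed_acyclic (E := E) good (a := c)); apply: tc_trans tce tec.
    by move=> c e; elim=> {c e} [c e|c e z /eG1 h _]; [apply: eG1|apply: tc_trans h].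
  exact.
have ba : b != a by rewrite eq_sym.
move=> x y; rewrite inE => /orP[|/pG //].
case: ifP => dab /eqP[-> ->].
  exists a, b; split=> //; case: (fixed_total E good aC bC ab) => // tba.
  by case: nt'; apply: wrong => //; rewrite upair_swap upair_lt.
exists b, a; split=> //; case: (fixed_total E good aC bC ab) => // tab.
case: nt; apply: wrong => //; last by rewrite upair_lt.
by rewrite (directedN E' good') ?inC' // dab.
Qed.

(** The second ranking is total and contained in the first, which is acyclic, so the two
    coincide. *)
Lemma tc_two_runs a b : a \in C -> b \in C -> tc F' (phi a) (phi b) <-> tc F a b.
Proof.
move=> aC bC; split; first exact: (pulled_tc second_run_pulled).
move=> tab; have ab : a != b.
  by apply/eqP => e; rewrite e in tab; apply: (fixed_acyclic (E := E) good) tab.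
case: (fixed_total E' good' (inC' aC) (inC' bC) (phi_neq aC bC ab)) => //.
move=> /(pulled_tc second_run_pulled bC aC) tba.
by case: (fixed_acyclic (E := E) good (a := a)); apply: tc_trans tab tba.
Qed.

Lemma winners_two_runs :
  rp_winners C' E' ordC' ordP' = map phi (rp_winners C E ordC ordP).
Proof.
rewrite /rp_winners phiC filter_map; congr map; apply: eq_in_filter => c cC /=.
rewrite has_map; congr (~~ _); apply: eq_in_has => d dC /=; rewrite -phiC.
case: (eqVneq d c) => [->|dc].
  by apply/idP/idP => /above_tc t; [case: (fixed_acyclic (E := E') good' t)|case: (fixed_acyclic (E := E) good t)].
apply/idP/idP => /above_tc t; apply: tc_above => //; last exact: phi_neq.
  exact/(tc_two_runs dC cC).
exact/(tc_two_runs dC cC).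
Qed.

End TwoRuns.

(** * Unanimous manipulation and renaming of candidates *)

Lemma wmg_cat E1 E2 a b : wmg (E1 ++ E2) a b = (wmg E1 a b + wmg E2 a b)%R.
Proof. by rewrite /wmg big_cat. Qed.

Lemma prefersN v a b : prefers v a b -> prefers v b a = false.
Proof. by rewrite /prefers => h; apply/negbTE; rewrite -leqNgt ltnW. Qed.

(** Voting [L] contributes the full weight of every manipulator to this margin, the most that any
    vote can. *)
Lemma wmg_unanimous W Wv L a b : size Wv = size W -> prefers L a b ->
  (wmg (zip W Wv) a b <= wmg (zip W (nseq (size W) L)) a b)%R.
Proof.
move=> + pL; elim: W Wv => [|w W IH] [|v Wv] //= [/IH]; rewrite /wmg !big_cons /= => h.
apply: lerD h; rewrite pL (prefersN pL).
by case: (prefers v a b); case: (prefers v b a); lia.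
Qed.

Section SameVote.
Variables (C : seq nat) (V : seq (nat * seq nat)) (W : seq nat) (Wv : seq (seq nat)).
Variables (ordC : seq nat) (ordP : seq (nat * nat)).
Hypotheses (good : good_orders C ordC ordP) (sW : size Wv = size W).
Let E := V ++ zip W Wv.
Let F := rp_fixed C E ordC ordP.
Let leF a b := above F a b || (a == b).
Definition rp_ranking := sort leF C.
Let E' := V ++ zip W (nseq (size W) rp_ranking).

Lemma perm_ranking : perm_eq rp_ranking C. Proof. exact/permPl/perm_sort. Qed.

(** The fixed edges order [C] totally, so sorting applies, and two candidates sorted the wrong way
    would close a cycle. *)
Lemma prefers_ranking a b : a \in C -> b \in C -> tc F a b -> prefers rp_ranking a b.
Proof.
move=> aC bC tab.
have ab : a != b.
  by apply/eqP => e; rewrite e in tab; apply: (fixed_acyclic (E := E) good) tab.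
have leT : transitive leF.
  move=> y x z /orP[/above_tc t1|/eqP->//] /orP[/above_tc t2|/eqP<-]; rewrite /leF.
    by case: (eqVneq x z) => [_|xz]; rewrite ?orbT // (tc_above (tc_trans t1 t2)).
  by case: (eqVneq x y) => [_|xz]; rewrite ?orbT // (tc_above t1).
have so : sorted leF rp_ranking.
  apply: (@sort_sorted_in _ (mem C)); last by apply/allP.
  move=> x y xC yC; rewrite /leF eq_sym; case: (eqVneq y x) => [_|yx]; rewrite ?orbT // !orbF.
  by case: (fixed_total E good yC xC yx) => t; rewrite (tc_above t) ?orbT // eq_sym.
rewrite /prefers ltnNge leq_eqVlt negb_or; apply/andP; split.
  apply/eqP => e; case/negP: ab; apply/eqP.
  by rewrite -(nth_index 0 (s := rp_ranking) (x := a)) ?(perm_mem perm_ranking) // -e nth_index // (perm_mem perm_ranking).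
apply/negP => h.
have mR x : x \in C -> x \in rp_ranking by rewrite (perm_mem perm_ranking).
have := sorted_ltn_index leT so _ _ (mR _ bC) (mR _ aC) h.
move=> /orP[/above_tc tba|/eqP e].
  by apply: (fixed_acyclic (E := E) good (a := a)); apply: tc_trans tab tba.
by rewrite e eqxx in ab.
Qed.

Lemma same_vote : rp_winners C E' ordC ordP = rp_winners C E ordC ordP.
Proof.
have le a b : a \in C -> b \in C -> tc F a b -> (wmg E a b <= wmg E' a b)%R.
  move=> aC bC t; rewrite !wmg_cat lerD2l; apply: wmg_unanimous => //.
  exact: prefers_ranking.
have ge a b : a \in C -> b \in C -> tc F a b -> (wmg E' b a <= wmg E b a)%R.
  by move=> aC bC t; rewrite (wmgN E' a b) (wmgN E a b) lerN2 le.
(* The margin under [E] is at least the nonnegative one under [E']; if both vanish, the same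
   candidate order decides. *)
have db a b : a \in C -> b \in C -> a != b -> tc F a b -> directed E' ordC b a -> directed E ordC b a.
  move=> aC bC _ /(ge _ _ aC bC) h; rewrite /directed; move: h; case: (ltgtP 0%R (wmg E b a)) => //=.
    by move=> h1 h2; have h3 := le_lt_trans h2 h1; rewrite (lt_gtF h3) (lt_eqF h3).
  by move=> <- h; rewrite (le_gtF h) /= => /andP[].
rewrite -[RHS]map_id; apply: (winners_two_runs good good) => //; first by rewrite map_id.
move=> a b c d aC bC ab tab d' cC dC cd tcd dcd.
have dba := db _ _ aC bC ab tab d'.
have pos E0 x y : directed E0 ordC x y -> rp_strength E0 (x, y) = wmg E0 x y.
  move=> h; have : (0 <= wmg E0 x y)%R by case/orP: h => [/ltW|/andP[/eqP ->]].
  by rewrite /rp_strength /= (wmgN E0 x y) => p; apply/max_idPl; lia.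
(* The pair directed against the ranking does not get stronger, and the edges that implied it do not
   get weaker; equal strengths leave the decision to the unchanged pair order. *)
have s1 : (rp_strength E' (a, b) <= rp_strength E (a, b))%R.
  by rewrite strength_swap (strength_swap E) !pos // ge.
have s2 : (rp_strength E (c, d) <= rp_strength E' (c, d))%R.
  by rewrite pos // /rp_strength /= le_max le.
rewrite /rp_before => /orP[h|/andP[/eqP h p]].
  by rewrite (lt_le_trans (le_lt_trans s1 h) s2).
by rewrite h in s2; have := le_trans s1 s2; rewrite le_eqVlt eq_sym => /orP[->|->//]; rewrite p orbT.
Qed.

End SameVote.

Definition unanimous (V : seq (nat * seq nat)) (W : seq nat) (v : seq nat) :=
  V ++ zip W (nseq (size W) v).

Lemma wmg_supports C V W v a b : a \in C -> b \in C -> wmg (unanimous V W v) a b =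
  ((wsum C V (index a C) (index b C) + (if prefers v a b then sumn W else 0))%:Z -
   (wsum C V (index b C) (index a C) + (if prefers v b a then sumn W else 0))%:Z)%R.
Proof.
move=> aC bC; rewrite wmg_cat.
have -> : wmg V a b = ((wsum C V (index a C) (index b C))%:Z - (wsum C V (index b C) (index a C))%:Z)%R.
  rewrite /wmg /wsum !nth_index //; elim: V => [|x V IH]; first by rewrite !big_nil.
  by rewrite !big_cons IH !PoszD opprD addrACA.
have -> : wmg (zip W (nseq (size W) v)) a b =
    ((if prefers v a b then sumn W else 0)%:Z - (if prefers v b a then sumn W else 0)%:Z)%R.
  rewrite /wmg; elim: W => [|w W IH]; first by rewrite big_nil !if_same.
  by rewrite /= big_cons IH /=; case: prefers; case: prefers; rewrite /= ?PoszD; lia.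
by rewrite !PoszD opprD addrACA.
Qed.

Lemma prefers_xor C v a b : perm_eq v C -> a \in C -> b \in C -> a != b ->
  prefers v b a = ~~ prefers v a b.
Proof.
move=> vC aC bC ab; rewrite /prefers -leqNgt [RHS]leq_eqVlt.
suff -> : (index b v == index a v) = false by [].
apply/eqP => e; case/negP: ab; apply/eqP.
by rewrite -(nth_index 0 (s := v) (x := a)) ?(perm_mem vC) // -e nth_index // (perm_mem vC).
Qed.

Lemma support_total C V W v a b : all (fun x => perm_eq x.2 C) V -> perm_eq v C ->
  a \in C -> b \in C -> a != b ->
  (wsum C V (index a C) (index b C) + (if prefers v a b then sumn W else 0)) +
  (wsum C V (index b C) (index a C) + (if prefers v b a then sumn W else 0)) =
  sumn (map fst V) + sumn W.
Proof.
move=> aV vC aC bC ab; rewrite (prefers_xor vC aC bC ab).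
suff -> : sumn (map fst V) = wsum C V (index a C) (index b C) + wsum C V (index b C) (index a C).
  by case: prefers => /=; lia.
rewrite /wsum !nth_index //; elim: V aV => [|x V IH] /=; first by rewrite !big_nil.
case/andP=> xC /IH ->; rewrite !big_cons (prefers_xor xC aC bC ab).
by case: prefers => /=; lia.
Qed.

Lemma wmg_le C V W v a b c d : all (fun x => perm_eq x.2 C) V -> perm_eq v C ->
  a \in C -> b \in C -> a != b -> c \in C -> d \in C -> c != d ->
  (wmg (unanimous V W v) a b <= wmg (unanimous V W v) c d)%R =
  (wsum C V (index a C) (index b C) + (if prefers v a b then sumn W else 0) <=
   wsum C V (index c C) (index d C) + (if prefers v c d then sumn W else 0)).
Proof.
move=> aV vC aC bC ab cC dC cd; rewrite !(@wmg_supports C) //.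
have balance (p q r s t : nat) : p + q = t -> r + s = t ->
  (p%:Z - q%:Z <= r%:Z - s%:Z)%R = (p <= r) by lia.
exact: balance (support_total W aV vC aC bC ab) (support_total W aV vC cC dC cd).
Qed.

Lemma index_map_in (f : nat -> nat) (s C : seq nat) a : {in C &, injective f} ->
  {subset s <= C} -> a \in C -> index (f a) (map f s) = index a s.
Proof.
move=> inj; elim: s => //= x s IH sub aC; rewrite IH //; last first.
  by move=> y ys; apply: sub; rewrite inE ys orbT.
by rewrite (inj_in_eq inj) // sub ?mem_head.
Qed.

(** * Instances with the same recorded bits *)

Section Renaming.
Variables (C C' : seq nat) (V V' : seq (nat * seq nat)) (W W' : seq nat).
Variables (ordC ordC' : seq nat) (ordP ordP' : seq (nat * nat)) (j : nat).
Hypotheses (good : good_orders C ordC ordP) (good' : good_orders C' ordC' ordP').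
Hypotheses (sC : size C = j) (sC' : size C' = j).
Hypotheses (aV : all (fun x => perm_eq x.2 C) V) (aV' : all (fun x => perm_eq x.2 C') V').
Let flat (s : seq (nat * nat)) := flatten [seq [:: x.1; x.2] | x <- s].
Hypothesis eC : [seq index c C | c <- ordC] = [seq index c C' | c <- ordC'].
Hypothesis eP : [seq index c C | c <- flat ordP] = [seq index c C' | c <- flat ordP'].
Hypothesis eT : forall (a b c d : 'I_j) (e f : bool),
  (wsum C V a b + (if e then sumn W else 0) <= wsum C V c d + (if f then sumn W else 0)) =
  (wsum C' V' a b + (if e then sumn W' else 0) <= wsum C' V' c d + (if f then sumn W' else 0)).

(** The bijection that preserves positions; by [eC] and [eP] it carries one pair of tie-breaking
    orders to the other. *)
Definition rename c := nth 0 C' (index c C).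

Lemma rename_inj : {in C &, injective rename}.
Proof.
case: good' => uC' _ _ a b aC bC /eqP; rewrite /rename nth_uniq ?sC' -?sC ?index_mem // => /eqP e.
by rewrite -(nth_index 0 aC) e nth_index.
Qed.

Lemma map_rename : C' = map rename C.
Proof.
case: good => uC _ _; apply: (@eq_from_nth _ 0); first by rewrite size_map sC sC'.
rewrite sC' => i ij.
by rewrite (nth_map 0) ?sC // /rename index_uniq ?sC.
Qed.

Lemma index_rename c : c \in C -> index (rename c) C' = index c C.
Proof. by case: good' => uC' _ _ cC; rewrite /rename index_uniq // sC' -sC index_mem. Qed.

Lemma rename_in c : c \in C -> rename c \in C'.
Proof. by move=> cC; rewrite map_rename map_f. Qed.

Lemma rename_list (s s' : seq nat) : {subset s' <= C'} ->
  [seq index c C | c <- s] = [seq index c C' | c <- s'] -> s' = map rename s.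
Proof.
move=> sub e; rewrite /rename (map_comp (nth 0 C') (index^~ C)) e -map_comp.
rewrite -[LHS]map_id; apply/eq_in_map => c /sub cC' /=; by rewrite nth_index.
Qed.

Lemma ordP_sub (D : seq nat) oC (s : seq (nat * nat)) x y : good_orders D oC s ->
  (x, y) \in s -> x \in D /\ y \in D.
Proof.
case=> _ _ /perm_mem h xs; have : upair (x, y) \in allupairs D by rewrite -h map_f.
by case: (upairP x y) => ->; rewrite mem_allupairs => /and3P[].
Qed.

Lemma ordC_rename : ordC' = map rename ordC.
Proof. by apply: rename_list => // c; case: good' => _ /perm_mem ->. Qed.

Lemma ordP_rename : ordP' = [seq (rename x.1, rename x.2) | x <- ordP].
Proof.
have : flat ordP' = map rename (flat ordP).
  apply: rename_list => // c /flattenP[l /mapP[[x y] xs ->]].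
  have [xC yC] := ordP_sub good' xs.
  by rewrite !inE => /orP[] /eqP ->.
elim: (ordP) (ordP') => [|[x y] s IH] [|[x' y'] s'] //= [-> -> /IH ->] //.
Qed.

Lemma pairpos_rename a b : a \in C -> b \in C ->
  rp_pairpos ordP' (rename a, rename b) = rp_pairpos ordP (a, b).
Proof.
move=> aC bC; rewrite /rp_pairpos ordP_rename -map_comp.
have : forall x y, (x, y) \in ordP -> x \in C /\ y \in C by move=> x y; apply: ordP_sub good.
elim: (ordP) => //= [[x y] s IH] sub; rewrite IH; last first.
  by move=> u v uv; apply: sub; rewrite inE uv orbT.
have [xC yC] := sub x y (mem_head _ _).
congr (if _ then _ else _); apply/eqP/eqP => /=.
  by move=> /upair_eq[[/rename_inj e1 /rename_inj e2]|[/rename_inj e1 /rename_inj e2]];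
    rewrite e1 // e2 // upair_swap.
by move=> /upair_eq[[-> ->]|[-> ->]] //; rewrite upair_swap.
Qed.

Section Vote.
Variable v : seq nat.
Hypothesis vC : perm_eq v C.
Let v' := map rename v.
Let E := unanimous V W v.
Let E' := unanimous V' W' v'.

Lemma perm_rename_vote : perm_eq v' C'.
Proof. by rewrite map_rename; apply: perm_map. Qed.

Lemma prefers_rename a b : a \in C -> b \in C -> prefers v' (rename a) (rename b) = prefers v a b.
Proof.
have sub : {subset v <= C} by move=> c; rewrite (perm_mem vC).
by move=> aC bC; rewrite /prefers !(index_map_in rename_inj sub).
Qed.

Lemma rename_neq a b : a \in C -> b \in C -> a != b -> rename a != rename b.
Proof. by move=> aC bC; apply: contra_neq; apply: rename_inj. Qed.

Lemma wmg_le_rename a b c d : a \in C -> b \in C -> a != b -> c \in C -> d \in C -> c != d ->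
  (wmg E' (rename a) (rename b) <= wmg E' (rename c) (rename d))%R = (wmg E a b <= wmg E c d)%R.
Proof.
move=> aC bC ab cC dC cd.
rewrite (wmg_le _ aV vC) // (wmg_le _ aV' perm_rename_vote) ?rename_in ?rename_neq //.
rewrite !index_rename // !prefers_rename //.
have lt x : x \in C -> index x C < j by rewrite -sC index_mem.
(* The bits [e] and [f] of the table become the preferences of [v] on the two pairs: the coalition
   adds its whole weight or nothing. *)
exact/esym/(eT (Ordinal (lt _ aC)) (Ordinal (lt _ bC)) (Ordinal (lt _ cC)) (Ordinal (lt _ dC))).
Qed.

Lemma directed_rename a b : a \in C -> b \in C -> a != b ->
  directed E' ordC' (rename a) (rename b) = directed E ordC a b.
Proof.
move=> aC bC ab; have ba : b != a by rewrite eq_sym.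
(* The table only compares margins with one another, so the sign of a margin is read from its
   comparison with the opposite margin. *)
have D0 (E0 : seq (nat * seq nat)) x y : (0 < wmg E0 x y)%R = ~~ (wmg E0 x y <= wmg E0 y x)%R.
  by rewrite (wmgN E0 x y) -ltNge; lia.
have D1 (E0 : seq (nat * seq nat)) x y : (wmg E0 x y == 0) =
    (wmg E0 x y <= wmg E0 y x)%R && (wmg E0 y x <= wmg E0 x y)%R.
  by rewrite (wmgN E0 x y); lia.
have sub : {subset ordC <= C} by case: good => _ /perm_mem h _ c; rewrite h.
rewrite /directed !D0 !D1 !wmg_le_rename // ordC_rename.
by rewrite !(index_map_in rename_inj sub).
Qed.

Lemma before_rename a b c d : a \in C -> b \in C -> a != b -> c \in C -> d \in C -> c != d ->
  rp_before E' ordP' (rename c, rename d) (rename a, rename b) = rp_before E ordP (c, d) (a, b).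
Proof.
move=> aC bC ab cC dC cd; have ba : b != a by rewrite eq_sym.
have dc : d != c by rewrite eq_sym.
rewrite /rp_before !pairpos_rename // !ltNge !eq_le /rp_strength /= !ge_max !le_max.
by rewrite !wmg_le_rename.
Qed.

Lemma winners_rename : rp_winners C' E' ordC' ordP' = map rename (rp_winners C E ordC ordP).
Proof.
apply: (winners_two_runs good good' rename_inj map_rename).
- by move=> a b aC bC ab _; rewrite directed_rename // eq_sym.
- by move=> a b c d aC bC ab _ _ cC dC cd _ _; rewrite before_rename.
Qed.
End Vote.
End Renaming.

(** * The decision procedure *)

(** The ordered pairs over [C] are increasing, decreasing or diagonal, and exchanging the summations
    shows the first two kinds to be equally many. *)
Lemma size_allupairs (C : seq nat) : uniq C -> (size (allupairs C)).*2 = size C * (size C).-1.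
Proof.
move=> uC; pose S := \sum_(a <- C) \sum_(b <- C) (a < b : nat).
have -> : size (allupairs C) = S.
  rewrite /allupairs size_allpairs_dep sumnE big_map; apply: eq_bigr => a _.
  by rewrite size_filter -sum1_count big_mkcond.
have S2 : S = \sum_(a <- C) \sum_(b <- C) (b < a : nat) by rewrite /S exchange_big.
have S3 : \sum_(a <- C) \sum_(b <- C) (a == b : nat) = size C.
  rewrite -sum1_size big_seq [RHS]big_seq; apply: eq_bigr => a aC.
  have <- : count_mem a C = 1 by rewrite count_uniq_mem // aC.
  by rewrite -sum1_count [RHS]big_mkcond; apply: eq_bigr => b _; rewrite /= eq_sym; case: eqP.
have : S + S + size C = size C * size C.
  have -> : size C * size C = \sum_(a <- C) \sum_(b <- C) 1.
    by rewrite sum1_size big_const_seq count_predT iter_addn addn0.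
  rewrite -[X in _ + X = _]S3 [X in _ + X + _ = _]S2 /S -!big_split /=.
  apply: eq_bigr => a _; rewrite -!big_split /=; apply: eq_bigr => b _.
  by case: ltngtP.
by rewrite addnn; case: (size C) => [|n] /=; lia.
Qed.

Section FlatPairs.
Variable tbP : seq nat -> seq (nat * nat).
Hypothesis permP : forall C : seq nat, uniq C -> perm_eq (map upair (tbP C)) (allupairs C).

Lemma size_flat_pairs C : uniq C -> size (flat_pairs tbP C) = size C * (size C).-1.
Proof.
move=> uC; rewrite -size_allupairs // -(perm_size (permP uC)) size_map /flat_pairs.
by elim: (tbP C) => //= x s ->.
Qed.

Lemma flat_pairs_sub C : uniq C -> {subset flat_pairs tbP C <= C}.
Proof.
move=> uC c /flattenP[l /mapP[[x y] xs ->]].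
have : upair (x, y) \in allupairs C by rewrite -(perm_mem (permP uC)) map_f.
by case: (upairP x y) => ->; rewrite mem_allupairs !inE => /and3P[h1 h2 _] /orP[] /eqP ->.
Qed.
End FlatPairs.

Section Decision.
Variables (tbC : seq nat -> seq nat) (tbP : seq nat -> seq (nat * nat)) (j : nat).
Hypothesis permC : forall C : seq nat, uniq C -> perm_eq (tbC C) C.
Hypothesis permP : forall C : seq nat, uniq C -> perm_eq (map upair (tbP C)) (allupairs C).
Variable m : winner_model.

Definition elects (p : nat) (ws : seq nat) : Prop :=
  match m with NonUnique => p \in ws | Unique => ws = [:: p] end.

Lemma tb_good C : uniq C -> good_orders C (tbC C) (tbP C).
Proof. by move=> uC; split=> //; [apply: permC|apply: permP]. Qed.

Lemma manipulable_unanimous I : wf_inst j I -> manipulable tbC tbP m I <->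
  exists2 v, perm_eq v (icands I) & elects (idist I) (rp_winners (icands I)
    (unanimous (ivoters I) (imanip I) v) (tbC (icands I)) (tbP (icands I))).
Proof.
case=> uC _ _ _; split=> [[Wv [sW aW el]]|[v vC el]].
  exists (rp_ranking (icands I) (ivoters I) (imanip I) Wv (tbC (icands I)) (tbP (icands I))).
    exact: perm_ranking.
  by rewrite /unanimous same_vote //; apply: tb_good.
exists (nseq (size (imanip I)) v); split=> //; first by rewrite size_nseq.
by apply/allP => u /nseqP[->].
Qed.

Definition summary (I : inst) (oC oP ip : seq nat) (tb : {ffun reg j * reg j -> bool}) :=
  [/\ oC = [seq index c (icands I) | c <- tbC (icands I)],
      oP = [seq index c (icands I) | c <- flat_pairs tbP (icands I)],
      ip = [:: index (idist I) (icands I)] &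
      tb = [ffun p => final_vals I p.1 <= final_vals I p.2]].

(** A unanimous vote that succeeds in [I] succeeds in [I'] after renaming, since the recorded
    position [ip] makes the renaming match the distinguished candidates. *)
Lemma manipulable_summary I I' oC oP ip tb : wf_inst j I -> wf_inst j I' ->
  summary I oC oP ip tb -> summary I' oC oP ip tb ->
  manipulable tbC tbP m I -> manipulable tbC tbP m I'.
Proof.
move=> wI wI' [e1 e2 e3 e4] [f1 f2 f3 f4] /(manipulable_unanimous wI)[v vC el].
apply/(manipulable_unanimous wI').
case: (wI) => uC sC aV pC; case: (wI') => uC' sC' aV' pC'.
have [g g'] := (tb_good uC, tb_good uC').
have eC := etrans (esym e1) f1; have eP := etrans (esym e2) f2.
have eT (a b c d : 'I_j) (e f : bool) : 
  (wsum (icands I) (ivoters I) a b + (if e then sumn (imanip I) else 0) <=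
   wsum (icands I) (ivoters I) c d + (if f then sumn (imanip I) else 0)) =
  (wsum (icands I') (ivoters I') a b + (if e then sumn (imanip I') else 0) <=
   wsum (icands I') (ivoters I') c d + (if f then sumn (imanip I') else 0)).
  by move: (etrans (esym e4) f4) => /ffunP /(_ (rsum a b e, rsum c d f)); rewrite !ffunE.
exists (map (rename (icands I) (icands I')) v).
  exact: (perm_rename_vote g sC sC' vC).
rewrite (winners_rename g g' sC sC' aV aV' eC eP eT vC).
have ep : rename (icands I) (icands I') (idist I) = idist I'.
  by move: f3; rewrite e3 => -[e]; rewrite /rename e nth_index.
move: el; rewrite /elects -ep; case: m => [h|->//]; exact: map_f.
Qed.

(** Asking for some manipulable instance with this summary avoids defining ranked pairs on
    summaries; by [manipulable_summary] all instances with the summary then give the same answer. *)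
Definition decide_summary (oC oP ip : seq nat) (tb : {ffun reg j * reg j -> bool}) : bool :=
  if excluded_middle_informative (exists I, [/\ wf_inst j I, summary I oC oP ip tb &
    manipulable tbC tbP m I]) then true else false.

Lemma ranked_pairs_decidable :
  poly_computable (fun C : seq nat => uniq C) enc_nats enc_nats tbC ->
  poly_computable (fun C : seq nat => uniq C) enc_nats enc_pairs tbP ->
  poly_decidable (wf_inst j) enc_inst (manipulable tbC tbP m).
Proof.
move=> [M1 [c1 [k1 run1]]] [M2 [c2 [k2 run2]]].
have sizeP C : uniq C -> size C = j -> size (flat_pairs tbP C) = j * j.-1.
  by move=> uC <-; apply: size_flat_pairs.
refine (@compile_decider idx (sym j M1 M2) sIn (eL j M1 M2) _ (wf_inst j) enc_inst (manipulable tbC tbP m) (main M1 M2 decide_summary) _).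
apply: tripleC (mainP decide_summary permC run1 run2 sizeP (@flat_pairs_sub _ permP)) _ _ => //.
move=> x b s [wx ->]; rewrite /decide_summary.
case: excluded_middle_informative => [h|h]; split=> //.
  by move=> _; case: h => I [wI sI]; apply: manipulable_summary sI _.
by move=> mx; case: h; exists x; split.
Qed.
End Decision.

Theorem theorem17 (tbC : seq nat -> seq nat) (tbP : seq nat -> seq (nat * nat)) :
  (forall C : seq nat, uniq C -> perm_eq (tbC C) C) ->
  (forall C : seq nat, uniq C -> perm_eq (map upair (tbP C)) (allupairs C)) ->
  poly_computable (fun C : seq nat => uniq C) enc_nats enc_nats tbC ->
  poly_computable (fun C : seq nat => uniq C) enc_nats enc_pairs tbP ->
  forall j : nat, j < 5 ->
    poly_decidable (wf_inst j) enc_inst (manipulable tbC tbP NonUnique) /\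
    poly_decidable (wf_inst j) enc_inst (manipulable tbC tbP Unique).
Proof.
move=> permC permP compC compP j _.
by split; apply: (ranked_pairs_decidable j permC permP _ compC compP).
Qed.
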